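(* Let $a \geq b > 0$ be integers, $n = a+b$, and let $K_{a,b}$ be the complete bipartite graph with parts of sizes $a$ and $b$ on the vertex set $[n]$. Write $n = \binom{h(n)}{2} + \alpha(n)$ with integers $h(n) \geq \alpha(n) > 0$ (this representation exists and is unique). Then for $1 \leq k \leq n-1$, \[ m_{\leq k}(\Delta^s(K_{a,b})) = \begin{cases} \binom{n}{2} - \binom{n-k}{2}, & \text{if } k \leq b-1 \text{ and } k \leq h(n)-2,\\ (k+1)n - (k+1)^2, & \text{if } k \leq b-1 \text{ and } k > h(n)-2,\\ ab, & \text{if } k > b-1. \end{cases} \]
   Context: Let $K$ be a field of characteristic $0$, $R = K[x_1,\dots,x_n]$. Let $\prec_{rev}$ be the degree reverse lexicographic order with $x_1 \prec x_2 \prec \cdots \prec x_n$: for monomials $u = x_1^{a_1}\cdots x_n^{a_n}$, $v = x_1^{b_1}\cdots x_n^{b_n}$, $u \prec_{rev} v$ iff $\deg u < \deg v$, or $\deg u = \deg v$ and the leftmost nonzero entry of $(b_1-a_1,\dots,b_n-a_n)$ is negative. A matrix $g = (a_{ij}) \in GL_n(K)$ acts on $R$ by the ring automorphism $x_j \mapsto \sum_i a_{ij} x_i$. For a homogeneous ideal $I$, there is a nonempty Zariski open $U \subset GL_n(K)$ on which the initial ideal $\mathrm{in}_{\prec_{rev}}(g(I))$ is constant; this is the generic initial ideal $\mathrm{gin}(I)$. For a graph $G$ on $[n]=\{1,\dots,n\}$ (no loops or multiple edges), $I_G \subset R$ is the ideal generated by all $x_ix_j$ ($i \neq j$) with $\{i,j\}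 \notin E(G)$ together with all squarefree monomials of degree $3$. $\mathrm{GIN}(G)$ is the set of monomials $x_ix_j$ (with $i \le j$, $i=j$ allowed) not in $\mathrm{gin}(I_G)$. The symmetric algebraic shifted graph $\Delta^s(G)$ is the graph on $[n]$ with edge set $\{\{i-1,j\} : x_ix_j \in \mathrm{GIN}(G),\ 2 \leq i \leq j \leq n\}$. For a graph $H$ on $[n]$ and $1 \le k \le n-1$, $m_{\leq k}(H)$ is the number of edges $\{i,j\}\in E(H)$ with $\min\{i,j\} \leq k$. *)

(* Defs.v *)
From HB Require Import structures.
From mathcomp Require Import all_boot all_order all_algebra.
From mathcomp Require Import mpoly.
From mathcomp Require boolp.

Set Implicit Arguments.
Unset Strict Implicit.
Unset Printing Implicit Defensive.
Import GRing.Theory.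
Local Open Scope ring_scope.

(* The variables x_1, ..., x_n and the vertices 1, ..., n are indexed by 'I_n,
   so that i : 'I_n stands for the integer i + 1. *)

Record sgraph (n : nat) := SGraph {
  adj :> rel 'I_n;
  adj_sym : ssrbool.symmetric adj;
  adj_irr : irreflexive adj }.

Section MonomialOrder.
Variable n : nat.
Implicit Types u v : 'X_{1..n}.

Definition revlt u v : bool :=
  (mdeg u < mdeg v)%N ||
  (mdeg u == mdeg v) &&
  [exists i : 'I_n, (v i < u i)%N &&
     [forall j : 'I_n, (j < i)%N ==> (u j == v j)]].

End MonomialOrder.

Section Ideals.
Variables (K : fieldType) (n : nat).
Local Notation R := {mpoly K[n]}.
Implicit Types (S I J : R -> Prop) (f : R) (m : 'X_{1..n}) (g : 'M[K]_n).

Definition ideal_gen S : R -> Prop := fun f =>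
  exists s : seq (R * R),
    (forall c, c \in s -> S c.2) /\ f = \sum_(c <- s) c.1 * c.2.

Definition initial_monomial f m : Prop :=
  m \in msupp f /\ forall m', m' \in msupp f -> m' != m -> revlt m' m.

Definition initial_ideal I : R -> Prop :=
  ideal_gen (fun p => exists f m,
    [/\ I f, initial_monomial f m & p = 'X_[m]]).

Definition act g f : R := f \mPo [tuple \sum_(i < n) g i j *: 'X_i | j < n].

Definition act_ideal g I : R -> Prop := fun f => exists2 f0, I f0 & f = act g f0.

(* The open subsets of GL_n(K) are the traces on it of those of the affine
   space of n x n matrices, whose coordinates are the entries of mxvec g. *)
Definition zariski_open_GL (U : 'M[K]_n -> Prop) : Prop :=
  exists P : {mpoly K[n * n]} -> Prop, forall g,
    U g <-> g \in unitmx /\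
            exists2 p, P p & p.@[fun i => mxvec g 0 i] != 0.

(* J = gin(I). *)
Definition is_gin I J : Prop :=
  exists U : 'M[K]_n -> Prop,
    [/\ zariski_open_GL U, exists g, U g &
        forall g, U g -> forall f, J f <-> initial_ideal (act_ideal g I) f].

Definition graph_ideal (G : sgraph n) : R -> Prop :=
  ideal_gen (fun p =>
    (exists i j : 'I_n, [/\ i != j, ~~ G i j & p = 'X_i * 'X_j]) \/
    (exists m, [/\ mdeg m = 3, forall i, (m i <= 1)%N & p = 'X_[m]])).

Definition GIN J m : Prop :=
  (exists i j : 'I_n, (i <= j)%N /\ m = (U_(i) + U_(j))%MM) /\ ~ J 'X_[m].

(* With 0-based indices, the condition 2 <= i becomes 0 < i, and the vertex
   i - 1 becomes i.-1. *)
Definition shift_edge J (u v : 'I_n) : Prop :=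
  exists i j : 'I_n,
    [/\ (0 < i)%N, (i <= j)%N, GIN J (U_(i) + U_(j))%MM,
        val u = i.-1 & v = j].

Definition shift_adj J : rel 'I_n := fun u v =>
  boolp.asbool (shift_edge J u v \/ shift_edge J v u).

Lemma shift_adj_sym J : ssrbool.symmetric (shift_adj J).
Proof.
by move=> u v; apply/boolp.asboolP/boolp.asboolP => -[]; by [left|right].
Qed.

Lemma shift_adj_irr J : irreflexive (shift_adj J).
Proof.
have h u : ~ shift_edge J u u.
  move=> [i [j [i0 ij _ ui uj]]]; move: ij.
  by rewrite -uj ui -ltnS prednK // ltnn.
by move=> u; apply/negP => /boolp.asboolP [] /h.
Qed.

Definition shift_graph J : sgraph n :=
  SGraph (shift_adj_sym J) (shift_adj_irr J).

(* H = Delta^s(G), computed over the field K. *)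
Definition is_symmetric_shift (G H : sgraph n) : Prop :=
  exists2 J, is_gin (graph_ideal G) J & H = shift_graph J.

End Ideals.

Section Graphs.
Variable n : nat.

Definition bip_adj (A : {set 'I_n}) : rel 'I_n :=
  fun i j => (i \in A) != (j \in A).

Lemma bip_adj_sym A : ssrbool.symmetric (bip_adj A).
Proof. by move=> i j; rewrite /bip_adj eq_sym. Qed.

Lemma bip_adj_irr A : irreflexive (bip_adj A).
Proof. by move=> i; rewrite /bip_adj eqxx. Qed.

(* The complete bipartite graph with parts A and ~: A. *)
Definition complete_bipartite (A : {set 'I_n}) : sgraph n :=
  SGraph (bip_adj_sym A) (bip_adj_irr A).

(* m_{<= k}(H); each edge is counted once, as its pair of increasing ends. *)
Definition m_le (k : nat) (H : sgraph n) : nat :=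
  #|[set p : 'I_n * 'I_n |
      [&& (p.1 < p.2)%N, H p.1 p.2 & (minn p.1.+1 p.2.+1 <= k)%N]]|.

End Graphs.

(* Main.v *)
(** Identify a quadric with its (doubled) symmetric matrix.  The degree two
    part of [act g I_G] is then the space of matrices [g S g^T], where [S] is
    symmetric, has zero diagonal and vanishes on the edges of [G].  In degree
    two, the initial monomials are the leading positions of this space for the
    lexicographic order on the pairs [i <= j], and the number of those with
    [i < m] is the dimension of the space of [S] such that the lower right
    block [i, j >= m] of [g S g^T] vanishes.

    For the complete bipartite graph with [m <= b], put [h = g^-1] and let
    [H] be the first [m] columns of [h].  Such an [S] is [H Q H^T] on one side
    of the bipartition and [- H Q H^T] on the other, for a unique quadric [Q] of
    [P^(m-1)] vanishing at the [n] points given by the rows of [H].  These points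
    being generic, the dimension is [max (0, 'C(m+1, 2) - n)].  For [m > b], every
    quadric in the variables [x_i] with [i >= m] is congruent to an element of
    [act g I_G] modulo the first [m] variables, so every pair [m <= i <= j] is
    leading.  Since [m_{<= k}] counts the non-leading pairs with
    [0 < i <= k], both cases are used with [m = k + 1], and the first one also
    with [m = 1]. *)

From HB Require Import structures.
Require Import Defs.
From mathcomp Require Import all_boot all_order all_algebra.
From mathcomp Require Import mpoly.
From mathcomp Require Import zify ring.
From mathcomp Require boolp.

Set Implicit Arguments.
Unset Strict Implicit.
Unset Printing Implicit Defensive.
Import GRing.Theory.

(** * Generic matrices *)

Section Generic.
Local Open Scope ring_scope.
Variables (K : fieldType) (n : nat).
Hypothesis charK0 : [pchar K] =i pred0.
Implicit Types (P Q : 'M[K]_n -> Prop) (g h : 'M[K]_n).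

Definition entries g : 'I_(n * n) -> K := fun i => mxvec g 0 i.

(** The basic open sets live in the affine space of all matrices, invertible or not; nonemptiness is
    witnessed by a point. *)
Definition generic P : Prop :=
  exists p : {mpoly K[n * n]},
    (exists g, p.@[entries g] != 0) /\ forall g, p.@[entries g] != 0 -> P g.

Lemma natr_eq0_char0 (i : nat) : (i%:R == 0 :> K) = (i == 0)%N.
Proof. by move/pcharf0P: charK0 => ->. Qed.

Lemma natr_inj_char0 : injective (fun i : nat => i%:R : K).
Proof.
have le_inj i j : (i <= j)%N -> i%:R = j%:R :> K -> i = j.
  move=> le_ij /eqP; rewrite eq_sym -subr_eq0 -natrB // natr_eq0_char0 subn_eq0.
  by move=> le_ji; apply/eqP; rewrite eqn_leq le_ij.
move=> i j /= eq_ij; case/orP: (leq_total i j) => le_ij; first exact: le_inj.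
by apply/esym/le_inj.
Qed.

Lemma poly_nonroot (q : {poly K}) : q != 0 -> exists t, q.[t] != 0.
Proof.
move=> q0; pose rs := [seq i%:R : K | i <- iota 0 (size q)].
case: (boolP (all (root q) rs)) => [allr|].
  have := max_poly_roots q0 allr.
  rewrite map_inj_uniq ?iota_uniq; last exact: natr_inj_char0.
  by rewrite size_map size_iota ltnn => /(_ isT).
by case/allPn=> t _ nt; exists t.
Qed.

Lemma meval_line (p : {mpoly K[n * n]}) g0 g1 :
  exists q : {poly K}, forall t, q.[t] = p.@[entries (g0 + t *: (g1 - g0))].
Proof.
pose l i := (entries g0 i)%:P + 'X * (entries (g1 - g0) i)%:P.
exists (\sum_(m <- msupp p) (p@_m)%:P * \prod_i l i ^+ m i) => t.
rewrite mevalE horner_sum; apply: eq_bigr => m _.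
rewrite hornerM hornerC horner_prod; congr (_ * _); apply: eq_bigr => i _.
by rewrite horner_exp /l !hornerE /entries [in RHS]linearD [in RHS]linearZ /= !mxE.
Qed.

(** Join a point of one open set to a point of the other. On this line both polynomials restrict to
    nonzero univariate ones, as seen at parameter 0 for [p] and 1 for [q], and their product has a
    nonroot. *)
Lemma generic_and P Q : generic P -> generic Q -> generic (fun g => P g /\ Q g).
Proof.
move=> [p [[g0 p0] pP]] [q [[g1 q1] qQ]].
exists (p * q); split; last first.
  by move=> g; rewrite mevalM mulf_eq0 negb_or => /andP[/pP ? /qQ].
have [p' p'E] := meval_line p g0 g1; have [q' q'E] := meval_line q g0 g1.
have p'0 : p' != 0.
  by apply: contraNneq p0 => p'0; rewrite -[g0]addr0 -(scale0r (g1 - g0)) -p'E p'0 horner0.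
have q'0 : q' != 0.
  apply: contraNneq q1 => q'0.
  by rewrite -[g1](subrK g0) addrC -[g1 - g0]scale1r -q'E q'0 horner0.
have [t] : exists t, (p' * q').[t] != 0 by apply: poly_nonroot; rewrite mulf_neq0.
by rewrite hornerM p'E q'E -mevalM; exists (g0 + t *: (g1 - g0)).
Qed.

Lemma generic_impl P Q : (forall g, P g -> Q g) -> generic P -> generic Q.
Proof. by move=> PQ [p [p0 pP]]; exists p; split=> // g /pP /PQ. Qed.

Lemma generic_always P : (forall g, P g) -> generic P.
Proof. by exists 1; split=> [|g _ //]; exists 0; rewrite meval1 oner_eq0. Qed.

Lemma generic_ex P : generic P -> exists g, P g.
Proof. by move=> [p [[g p0] pP]]; exists g; apply: pP. Qed.

Lemma generic_forall (T : finType) (P : T -> 'M[K]_n -> Prop) :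
  (forall t, generic (P t)) -> generic (fun g => forall t, P t g).
Proof.
move=> gP.
suff: generic (fun g => forall t, t \in enum T -> P t g).
  by apply: generic_impl => g Pg t; apply: Pg; rewrite mem_enum.
elim: (enum T) => [|t s IHs]; first exact: generic_always.
apply: generic_impl (generic_and (gP t) IHs) => g [Pt Ps] t'.
by rewrite inE => /predU1P[->|/Ps].
Qed.

Lemma generic_unitmx r (M : 'M[{mpoly K[n * n]}]_r) (N : 'M[K]_n -> 'M[K]_r) :
    (forall g i j, (M i j).@[entries g] = N g i j) ->
    (exists g, N g \in unitmx) ->
  generic (fun g => N g \in unitmx).
Proof.
move=> MN [g0 Ng0].
have detE g : (\det M).@[entries g] = \det (N g).
  rewrite -det_map_mx; congr (\det _).
  by apply/matrixP=> i j; rewrite mxE; apply: MN.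
exists (\det M); split; first by exists g0; rewrite detE -unitfE -unitmxE.
by move=> g; rewrite detE -unitfE -unitmxE.
Qed.

Definition coordX (i j : 'I_n) : {mpoly K[n * n]} := 'X_(mxvec_index i j).

Lemma coordXE g i j : (coordX i j).@[entries g] = g i j.
Proof. by rewrite /coordX mevalXU /entries mxvecE. Qed.

Lemma generic_minor r (f c : 'I_r -> 'I_n) : injective f -> injective c ->
  generic (fun h => mxsub f c h \in unitmx).
Proof.
move=> finj cinj.
apply: (generic_unitmx (M := \matrix_(i, j) coordX (f i) (c j))).
  by move=> g i j; rewrite !mxE coordXE.
(* A partial permutation matrix with an identity block at rows [f] and columns [c]. *)
exists (\matrix_(i, j) [exists s, (f s == i) && (c s == j)]%:R).
suff -> : mxsub f c (\matrix_(i, j) [exists s, (f s == i) && (c s == j)]%:R) = 1%:M :> 'M[K]_r.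
  exact: unitmx1.
apply/matrixP=> i j; rewrite !mxE; congr ((nat_of_bool _)%:R).
apply/existsP/eqP => [[s /andP[/eqP/finj -> /eqP/cinj //]]|->].
by exists j; rewrite !eqxx.
Qed.

(* [invmx h] is not polynomial in [h] but [\adj h] is, hence the scalar [s]. *)
Lemma generic_zariski (U : 'M[K]_n -> Prop) :
    zariski_open_GL U -> (exists g, U g) ->
  generic (fun h => h \in unitmx /\ exists2 s, s != 0 & U (s *: invmx h)).
Proof.
move=> [P UP] [g0 /UP[ug0 [p Pp p0]]].
have s0 : \det g0 != 0 by rewrite -unitfE -unitmxE.
pose M : 'M[{mpoly K[n * n]}]_n := \matrix_(i, j) coordX i j.
(* The factor [\det g0] makes the substitution send [invmx g0] to [g0], where [p] does not
   vanish. *)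
pose lq := [tuple (\det g0)%:MP * mxvec (\adj M) 0 i | i < n * n].
have adjE h : map_mx (meval (entries h)) (\adj M) = \adj h.
  rewrite map_mx_adj; congr (\adj _).
  by apply/matrixP=> i j; rewrite !mxE; apply: coordXE.
have lqE h : (p \mPo lq).@[entries h] = p.@[entries (\det g0 *: \adj h)].
  rewrite comp_mpoly_meval; apply: meval_eq => i /=.
  rewrite tnth_mktuple mevalM mevalC /entries linearZ [in RHS]mxE; congr (_ * _).
  by case/mxvec_indexP: i => i j; rewrite !mxvecE -adjE [in RHS]mxE.
have gen_unit : generic (fun h => h \in unitmx).
  by apply: generic_impl (generic_minor (@inj_id _) (@inj_id _)) => h; rewrite mxsub_id.
apply: generic_impl (generic_and gen_unit
  (_ : generic (fun h => p.@[entries (\det g0 *: \adj h)] != 0))).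
  move=> h [uh ph]; split=> //; exists (\det g0 * \det h).
    by rewrite mulf_neq0 // -unitfE -unitmxE.
  have -> : (\det g0 * \det h) *: invmx h = \det g0 *: \adj h.
    by rewrite /invmx uh scalerA mulrK // -unitmxE.
  apply/UP; split; last by exists p.
  rewrite unitmxE detZ unitfE mulf_neq0 ?expf_neq0 //.
  have /(congr1 determinant) := mul_mx_adj h.
  rewrite det_mulmx det_scalar => adj0.
  have: \det h * \det (\adj h) != 0 by rewrite adj0 expf_neq0 // -unitfE -unitmxE.
  by rewrite mulf_eq0 negb_or => /andP[].
exists (p \mPo lq); split; last by move=> h; rewrite lqE.
exists (invmx g0); rewrite lqE.
suff -> : \det g0 *: \adj (invmx g0) = g0 by [].
have ug0' : invmx g0 \in unitmx by rewrite unitmx_inv.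
have := invmxK g0; rewrite {1}/invmx ug0' det_inv invrK. exact.
Qed.
End Generic.

(** * Counting leading positions *)

Section LeadingPositions.
Local Open Scope ring_scope.
Variables (K : fieldType) (V : vectType K) (I : finType).
Variables (c : I -> 'Hom(V, K^o)) (r : I -> nat) (D : {set I}) (U : {vspace V}).
Hypothesis r_inj : injective r.

(** A filtration of [U] by the rank of the last nonzero coordinate; [leading p] says that it jumps
    at [p]. *)
Definition lead_below B : {vspace V} :=
  (U :&: \bigcap_(q in D | (B <= r q)%N) lker (c q))%VS.

Definition leading p : bool :=
  (p \in D) && ~~ (lead_below (r p).+1 <= lker (c p))%VS.

Lemma lead_belowP B v : reflect
  (v \in U /\ forall q, q \in D -> (B <= r q)%N -> c q v = 0) (v \in lead_below B).
Proof.
apply: (iffP memv_capP) => -[vU cv]; split=> //.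
  move=> q qD qB; apply/eqP; rewrite -memv_ker.
  by move: cv; rewrite memvE => /subv_bigcapP/(_ q); rewrite qD qB => /(_ isT).
rewrite memvE; apply/subv_bigcapP => q /andP[qD qB].
by rewrite -memvE memv_ker cv.
Qed.

Lemma leadingP p : reflect
  [/\ p \in D & exists v, [/\ v \in U, c p v != 0 &
     forall q, q \in D -> (r p < r q)%N -> c q v = 0]] (leading p).
Proof.
apply: (iffP andP) => -[pD].
  case/subvPn=> v /lead_belowP[vU cq]; rewrite memv_ker => cp.
  by split=> //; exists v.
move=> [v [vU cp cq]]; split=> //.
by apply/subvPn; exists v; rewrite ?memv_ker //; apply/lead_belowP.
Qed.

Lemma dim_cap_lker (F : {vspace V}) (f : 'Hom(V, K^o)) :
  \dim F = (\dim (F :&: lker f) + ~~ (F <= lker f)%VS)%N.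
Proof.
rewrite -(limg_ker_dim f F); congr (_ + _)%N.
have le1 : (\dim (f @: F) <= 1)%N.
  by apply: leq_trans (dimvS (subvf _)) _; rewrite dimvf.
case: (boolP (F <= lker f)%VS) => [/[dup] sF|nF] /=.
  by rewrite lkerE => /eqP ->; rewrite dimv0.
by apply/eqP; rewrite eqn_leq le1 lt0n dimv_eq0 -lkerE.
Qed.

(** Ranks being distinct, passing from [B.+1] to [B] adds at most one linear condition, which lowers
    the dimension by one exactly at a leading position. The hypothesis on [c] makes the bottom step
    zero. *)
Lemma dim_lead_below B : (forall v, v \in U -> (forall q, q \in D -> c q v = 0) -> v = 0) ->
  \dim (lead_below B) = #|[set p | leading p & (r p < B)%N]|.
Proof.
move=> c_inj; elim: B => [|B IHB].
  rewrite (_ : [set p | _ & _] = set0) ?cards0; last by apply/setP=> p; rewrite !inE andbF.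
  apply/eqP; rewrite dimv_eq0 -subv0; apply/subvP => v /lead_belowP[vU cv].
  by rewrite memv0; apply/eqP/c_inj => // q /cv; apply.
case: (pickP [pred q | (q \in D) && (r q == B)]) => [q /andP[qD /eqP rq]|noq].
  rewrite (dim_cap_lker _ (c q)) (_ : (_ :&: _)%VS = lead_below B); last first.
    apply/eqP; rewrite eqEsubv; apply/andP; split; apply/subvP => v.
      move=> /memv_capP[/lead_belowP[vU cv] vq]; apply/lead_belowP; split=> // q' q'D.
      rewrite leq_eqVlt => /predU1P[|/cv -> //]; rewrite -rq => /r_inj <-.
      by apply/eqP; rewrite -memv_ker.
    move=> /lead_belowP[vU cv]; apply/memv_capP; split.
      by apply/lead_belowP; split=> // q' q'D /ltnW /cv ->.
    by rewrite memv_ker cv ?rq.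
  rewrite IHB addnC (_ : ~~ _ = leading q); last by rewrite /leading qD rq.
  rewrite [in RHS](cardD1 q) inE ltnS rq leqnn andbT; congr (_ + _)%N; apply: eq_card => p.
  rewrite !inE ltnS; case: eqVneq => [->|npq] /=; first by rewrite rq ltnn andbF.
  by rewrite [in RHS]leq_eqVlt -rq (inj_eq r_inj) (negPf npq).
rewrite (_ : lead_below B.+1 = lead_below B).
  rewrite IHB; apply: eq_card => p; rewrite !inE ltnS [in RHS]leq_eqVlt.
  case: (boolP (leading p)) => //= /andP[pD _].
  by move: (noq p); rewrite /= pD /= => ->.
apply/eqP; rewrite eqEsubv; apply/andP; split; apply/subvP => v.
  move=> /lead_belowP[vU cv]; apply/lead_belowP; split=> // q qD.
  by rewrite leq_eqVlt => /predU1P[rq|/cv -> //]; move: (noq q); rewrite /= qD rq eqxx.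
by move=> /lead_belowP[vU cv]; apply/lead_belowP; split=> // q qD /ltnW /cv ->.
Qed.

End LeadingPositions.

(** * The reverse lexicographic order in degree two *)

Section DegreeTwoMonomials.
Local Open Scope ring_scope.
Variable n : nat.
Implicit Types (u v : 'X_{1..n}) (p q : 'I_n * 'I_n).

(** The lexicographic order is packed into one number, so that the condition [m <= p.1] becomes the
    rank bound [m * n]. *)
Definition lex_rank p : nat := (p.1 * n + p.2)%N.

Definition ordered_pairs : {set 'I_n * 'I_n} := [set p : 'I_n * 'I_n | (p.1 <= p.2)%N].

Definition pair_mnm p : 'X_{1..n} := (U_(p.1) + U_(p.2))%MM.


Lemma lex_rank_inj : injective lex_rank.
Proof.
move=> [i j] [k l]; rewrite /lex_rank /= => e.
have n0 : (0 < n)%N by apply: leq_ltn_trans (ltn_ord i).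
have := congr1 (modn^~ n) e; have := congr1 (divn^~ n) e; rewrite /=.
by rewrite !divnMDl // !modnMDl !divn_small // !modn_small // !addn0 => /val_inj-> /val_inj->.
Qed.

Lemma lex_rank_lt p q : (lex_rank p < lex_rank q)%N ->
  (p.1 < q.1)%N \/ p.1 = q.1 /\ (p.2 < q.2)%N.
Proof.
rewrite /lex_rank; case: p q => [i j] [k l] /=.
case: (ltngtP i k) => [ik|ki|/val_inj ->] /=; [by left| |].
  move=> lt; exfalso; move: lt; apply/negP; rewrite -leqNgt.
  apply: leq_trans (leq_addr _ _); apply: leq_trans (_ : k.+1 * n <= _)%N.
    by rewrite mulSn addnC leq_add2r ltnW.
  by rewrite leq_mul2r ki orbT.
by rewrite ltn_add2l; right.
Qed.

Lemma lex_rank_ge p (m : nat) : (m * n <= lex_rank p)%N = (m <= p.1)%N.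
Proof.
have n0 : (0 < n)%N by apply: leq_ltn_trans (ltn_ord p.1).
by rewrite -leq_divRL // /lex_rank divnMDl // divn_small // addn0.
Qed.

Lemma pair_mnmE p k : pair_mnm p k = ((p.1 == k) + (p.2 == k))%N.
Proof. by rewrite mnmDE !mnm1E. Qed.

Lemma mdeg_pair p : mdeg (pair_mnm p) = 2%N.
Proof. by rewrite mdegD !mdeg1. Qed.

Lemma mdeg2P u : mdeg u = 2%N -> exists2 p, p \in ordered_pairs & u = pair_mnm p.
Proof.
move=> du; have [i ui] : exists i, (0 < u i)%N.
  apply/existsP; apply: contra_eqT du => /existsPn u0; rewrite mdegE big1 // => i _.
  by apply/eqP; rewrite eqn0Ngt u0.
have uE : u = (U_(i) + (u - U_(i)))%MM.
  by rewrite addmC submK //; apply/mnm_lepP => k; rewrite mnm1E; case: eqP => // <-.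
have : mdeg (u - U_(i))%MM == 1%N.
  by move/(congr1 (@mdeg n)): uE; rewrite mdegD mdeg1 du => -[e]; apply/eqP/esym.
move=> /mdeg1P[j /eqP uj]; rewrite uj in uE.
case: (leqP i j) => [ij|/ltnW ji]; first by exists (i, j); rewrite ?inE.
by exists (j, i); rewrite ?inE // uE addmC.
Qed.

(** The exponents first differ at [p.1], or at [p.2] when the first indices agree. There
    [pair_mnm p] has the larger exponent, which makes it the smaller monomial. *)
Lemma revlt_pair p q : p \in ordered_pairs -> q \in ordered_pairs ->
  (lex_rank p < lex_rank q)%N -> revlt (pair_mnm p) (pair_mnm q).
Proof.
rewrite !inE => p12 q12 /lex_rank_lt lt; apply/orP; right.
rewrite !mdeg_pair eqxx /=; apply/existsP.
case: lt => [lt1|[e1 lt2]]; [exists p.1 | exists p.2]; rewrite !pair_mnmE.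
  rewrite eqxx -!val_eqE /= (gtn_eqF lt1) (gtn_eqF (leq_trans lt1 q12)) //=.
  apply/forallP => j; apply/implyP => jp; rewrite !pair_mnmE -!val_eqE /=.
  have jq := ltn_trans jp lt1.
  by rewrite (gtn_eqF jp) (gtn_eqF jq) (gtn_eqF (leq_trans jp p12)) (gtn_eqF (leq_trans jq q12)).
rewrite e1 eqxx ltn_add2l -[q.2 == _]val_eqE /= (gtn_eqF lt2) /=; apply/forallP => j.
apply/implyP => jp; rewrite !pair_mnmE e1 eqn_add2l -!val_eqE /=.
by rewrite (gtn_eqF jp) (gtn_eqF (ltn_trans jp lt2)).
Qed.

Lemma revlt_asym u v : revlt u v -> ~~ revlt v u.
Proof.
rewrite /revlt negb_or => /orP[lt|/andP[/eqP-> /existsP[i /andP[ui /forallP ei]]]].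
  by rewrite -leqNgt ltnW //= (gtn_eqF lt).
rewrite ltnn eqxx /=; apply/existsPn => j; apply/negP => /andP[vj /forallP ej].
case: (ltngtP i j) => [ij|ji|/val_inj ij].
- by move: (ej i) ui; rewrite ij => /eqP ->; rewrite ltnn.
- by move: (ei j) vj; rewrite ji => /eqP ->; rewrite ltnn.
by move: vj; rewrite -ij ltnNge ltnW.
Qed.

Lemma pair_mnm_inj : {in ordered_pairs &, injective pair_mnm}.
Proof.
have lt_neq p q : p \in ordered_pairs -> q \in ordered_pairs ->
    (lex_rank p < lex_rank q)%N -> pair_mnm p <> pair_mnm q.
  move=> pD qD lt e; have r := revlt_pair pD qD lt.
  by have := revlt_asym r; rewrite e in r *; rewrite r.
move=> p q pD qD e; apply: lex_rank_inj.
case: (ltngtP (lex_rank p) (lex_rank q)) => // lt; first by case: (lt_neq p q).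
by case: (lt_neq q p).
Qed.

End DegreeTwoMonomials.

(** * Initial ideals and leading positions *)

Section QuadraticPart.
Local Open Scope ring_scope.
Variables (K : fieldType) (n : nat).
Local Notation R := {mpoly K[n]}.
Implicit Types (f q : R) (g : 'M[K]_n).

(* The Hessian at the origin, on which [act g] acts by congruence. *)
Definition hess f : 'M[K]_n := \matrix_(i, j) (f^`M(i)^`M(j))@_0.

Definition order_ge2 f : Prop := f@_0 = 0 /\ forall i, f^`M(i)@_0 = 0.

Lemma hessE f p : hess f p.1 p.2 = f@_(pair_mnm p) *+ (p.1 == p.2).+1.
Proof.
rewrite mxE mcoeff_deriv mcoeff_deriv mnm0E add0m mnm1E mulr1n addmC.
by rewrite eq_sym.
Qed.

Lemma mderiv_sum i (I : Type) (s : seq I) (P : pred I) (F : I -> R) :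
  (\sum_(x <- s | P x) F x)^`M(i) = \sum_(x <- s | P x) (F x)^`M(i).
Proof. exact: (big_morph _ (mderivD i) (mderiv0 _ i)). Qed.

Lemma mcoeff_sum m (I : Type) (s : seq I) (P : pred I) (F : I -> R) :
  (\sum_(x <- s | P x) F x)@_m = \sum_(x <- s | P x) (F x)@_m.
Proof. exact: (big_morph _ (mcoeffD m) (mcoeff0 _ m)). Qed.

Lemma hess_sum (I : Type) (s : seq I) (P : pred I) (F : I -> R) :
  hess (\sum_(x <- s | P x) F x) = \sum_(x <- s | P x) hess (F x).
Proof.
apply/matrixP=> i j; rewrite summxE mxE !mderiv_sum mcoeff_sum.
by apply: eq_bigr => x _; rewrite mxE.
Qed.

Lemma hessZ a f : hess (a *: f) = a *: hess f.
Proof. by apply/matrixP=> i j; rewrite !mxE !mderivZ mcoeffZ. Qed.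

Lemma mcoeff0M f q : (f * q)@_0 = f@_0 * q@_0.
Proof. exact: (mcoeff0_is_multiplicative _ _).1. Qed.

Lemma order_ge2_mul f q : order_ge2 q -> order_ge2 (f * q).
Proof.
move=> [q0 q1]; split; first by rewrite mcoeff0M q0 mulr0.
by move=> i; rewrite mderivM mcoeffD !mcoeff0M q0 q1 !mulr0 addr0.
Qed.

Lemma order_ge2_sum (I : eqType) (s : seq I) (F : I -> R) :
  (forall x, x \in s -> order_ge2 (F x)) -> order_ge2 (\sum_(x <- s) F x).
Proof.
move=> F2; split=> [|i]; rewrite ?mderiv_sum mcoeff_sum big_seq big1 // => x /F2[] //.
Qed.

Lemma order_ge2_mdeg f m : order_ge2 f -> m \in msupp f -> (2 <= mdeg m)%N.
Proof.
move=> [f0 f1]; rewrite mcoeff_msupp; apply: contraNT; rewrite -ltnNge.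
case E: (mdeg m) => [|[|d]] // _.
  by move/eqP: E; rewrite mdeg_eq0 => /eqP ->; rewrite f0.
move/eqP/mdeg1P: E => [i /eqP ->].
by move: (f1 i); rewrite mcoeff_deriv mnm0E add0m mulr1n => ->; rewrite eqxx.
Qed.

(** As [q] starts in degree two, only the constant term of [f] matters there. *)
Lemma hess_mul f q : order_ge2 q -> hess (f * q) = f@_0 *: hess q.
Proof.
move=> [q0 q1]; apply/matrixP=> i j; rewrite !mxE !(mderivM, mderivD, mcoeffD, mcoeff0M).
by rewrite q0 !q1 !mulr0 !add0r.
Qed.

Lemma actM g : {morph act g : f q / f * q}.
Proof. by move=> f q; rewrite /act rmorphM. Qed.

Lemma act_sum g (I : Type) (s : seq I) (P : pred I) (F : I -> R) :
  act g (\sum_(x <- s | P x) F x) = \sum_(x <- s | P x) act g (F x).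
Proof. by rewrite /act raddf_sum. Qed.

Lemma actZ g a f : act g (a *: f) = a *: act g f.
Proof. by rewrite /act linearZ. Qed.

Lemma actX g i : act g 'X_i = \sum_k g k i *: 'X_k.
Proof. by rewrite /act comp_mpolyXU -tnth_nth tnth_mktuple. Qed.

Lemma mderiv_actX g i k : (act g 'X_i)^`M(k) = (g k i)%:MP.
Proof.
rewrite actX mderiv_sum (bigD1 k) //= big1 ?addr0; last first.
  by move=> l lk; rewrite mderivZ mderivX mnm1E (negPf lk) scale0r scaler0.
rewrite mderivZ mderivX mnm1E eqxx scale1r.
rewrite (_ : (_ - _)%MM = 0%MM) ?mpolyX0 ?alg_mpolyC //.
by apply/mnmP=> l; rewrite mnmBE subnn mnm0E.
Qed.

Lemma mcoeff_dhomog d f m : f \is d.-homog -> mdeg m != d -> f@_m = 0.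
Proof. exact: dhomog_nemf_coeff. Qed.

Lemma actX_dhomog g m : act g 'X_[m] \is (mdeg m).-homog.
Proof.
rewrite /act comp_mpolyX mdegE.
elim/big_rec2: _ => [|i d q _ qd]; first exact: dhomog1.
apply: dhomogM qd; rewrite -[X in X.-homog]mul1n tnth_mktuple; apply: dhomogMn.
by apply: rpred_sum => k _; apply: rpredZ; rewrite dhomogX; apply/eqP/mdeg1.
Qed.

Lemma actX0 g i : (act g 'X_i)@_0 = 0.
Proof. by rewrite (mcoeff_dhomog (actX_dhomog _ _)) // mdeg1 mdeg0. Qed.

(** The coefficients of [act g 'X_i] form column [i] of [g], so the product of two such forms has a
    symmetrized outer product of columns as Hessian. *)
Lemma hess_actXX g i j :
  hess (act g ('X_i * 'X_j)) = g *m (delta_mx i j + delta_mx j i) *m g^T.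
Proof.
apply/matrixP=> k l; rewrite mxE actM !(mderivM, mderivD, mcoeffD, mcoeff0M).
rewrite !mderiv_actX !mderivC !mcoeffC !actX0 !eqxx !mulr1 !mul0r ?add0r ?addr0.
have E a b : (g *m delta_mx a b *m g^T) k l = g k a * g l b.
  rewrite -(mul_delta_mx (0 : 'I_1)) mulmxA -mulmxA -colE -rowE.
  by rewrite mxE big_ord1 !mxE.
by rewrite mulmxDr mulmxDl [in RHS]mxE !E [g l i * _]mulrC.
Qed.

End QuadraticPart.

(** * Degree two part of the initial ideal of a graph ideal *)

Section InitialIdeal.
Local Open Scope ring_scope.
Variables (K : fieldType) (n : nat) (G : sgraph n).
Hypothesis charK0 : [pchar K] =i pred0.
Local Notation R := {mpoly K[n]}.
Implicit Types (f : R) (g S : 'M[K]_n) (p q : 'I_n * 'I_n).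

(** Designed as a linear map whose kernel is the space of symmetric matrices vanishing on the
    diagonal and on the edges. *)
Definition nonedge_defect S : 'M[K]_n :=
  \matrix_(i, j) if (i == j) || G i j then S i j else S i j - S j i.

Fact nonedge_defect_is_linear : linear nonedge_defect.
Proof.
move=> a S T; apply/matrixP=> i j; rewrite !mxE; case: ifP => // _.
by rewrite mulrBr opprD addrACA.
Qed.

HB.instance Definition _ := GRing.isLinear.Build K 'M[K]_n 'M[K]_n _
  nonedge_defect nonedge_defect_is_linear.

Definition nonedge_space : {vspace 'M[K]_n} := lker (linfun nonedge_defect).

Lemma nonedge_spaceP S : reflect
  (S^T = S /\ forall i j, (i == j) || G i j -> S i j = 0) (S \in nonedge_space).
Proof.
rewrite memv_ker lfunE /=; apply: (iffP eqP) => [S0|[Sym S0]].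
  have Sd i j : (i == j) || G i j -> S i j = 0.
    by move=> ij; move/matrixP/(_ i j): S0; rewrite !mxE ij.
  split=> //; apply/matrixP=> i j; rewrite mxE.
  case: (boolP ((i == j) || G i j)) => ij.
    by rewrite !Sd // eq_sym adj_sym.
  move/matrixP/(_ i j): S0; rewrite !mxE (negPf ij) => /eqP.
  by rewrite subr_eq0 => /eqP.
apply/matrixP=> i j; rewrite !mxE; case: ifP => [/S0 //|_].
by rewrite -[in X in _ - X]Sym mxE subrr.
Qed.

Definition congr_entry g p S : K^o := (g *m S *m g^T) p.1 p.2.

Fact congr_entry_is_linear g p : linear (congr_entry g p).
Proof.
move=> a S T; rewrite /congr_entry mulmxDr mulmxDl mxE -scalemxAr -scalemxAl mxE.
by [].
Qed.

HB.instance Definition _ g p := GRing.isLinear.Build K 'M[K]_n K^o _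
  (congr_entry g p) (congr_entry_is_linear g p).

Lemma order_ge2_XX g i j : order_ge2 (act g ('X_i * 'X_j) : R).
Proof.
split=> [|k]; first by rewrite actM mcoeff0M actX0 mul0r.
by rewrite actM mderivM mcoeffD !mcoeff0M !actX0 mulr0 mul0r addr0.
Qed.

(** A non-edge contributes a symmetrized elementary matrix, cubic generators contribute nothing in
    degree two, and multipliers act through their constant terms. *)
Lemma act_ideal_hess g f : act_ideal g (graph_ideal G) f ->
  order_ge2 f /\ exists2 S, S \in nonedge_space & hess f = g *m S *m g^T.
Proof.
move=> [f0 [s [sI ->]] ->]; rewrite act_sum.
have gen2 c : c \in s -> order_ge2 (act g c.2) /\
    exists2 S, S \in nonedge_space & hess (act g c.2) = g *m S *m g^T.
  move=> /sI[[i [j [ij nij ->]]]|[m [m3 _ ->]]].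
    split; first exact: order_ge2_XX.
    exists (delta_mx i j + delta_mx j i); last exact: hess_actXX.
    apply/nonedge_spaceP; split.
      by rewrite linearD /= !trmx_delta addrC.
    move=> k l kl; rewrite !mxE.
    have E a b : a != b -> ~~ G a b -> (k == a) && (l == b) = false.
      move=> ab nab; apply/andP => -[/eqP ka /eqP lb]; move: kl.
      by rewrite ka lb (negPf ab) (negPf nab).
    by rewrite !E ?addr0 // 1?eq_sym // adj_sym.
  have hom := actX_dhomog g m; rewrite m3 in hom.
  split; first split=> [|k].
  - by rewrite (mcoeff_dhomog hom) ?mdeg0.
  - rewrite mcoeff_deriv add0m (mcoeff_dhomog hom) ?mdeg1 // mul0rn //.
  exists 0; first exact: mem0v.
  apply/matrixP=> k l; rewrite mulmx0 mul0mx.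
  by rewrite (hessE _ (k, l)) (mcoeff_dhomog hom) ?mdeg_pair // mul0rn mxE.
have gen2' c : c \in s -> order_ge2 (act g (c.1 * c.2)) /\
    exists2 S, S \in nonedge_space & hess (act g (c.1 * c.2)) = g *m S *m g^T.
  move=> /gen2[c2 [S SG Sc]]; rewrite actM; split; first exact: order_ge2_mul.
  exists ((act g c.1)@_0 *: S); first exact: memvZ.
  by rewrite hess_mul // Sc -scalemxAr -scalemxAl.
split; first by apply: order_ge2_sum => c /gen2'[].
rewrite hess_sum; elim: s gen2' {sI gen2} => [|c s IHs] gens.
  by exists 0; rewrite ?mem0v // big_nil mulmx0 mul0mx.
have [|S SG Ss] := IHs; first by move=> d ds; apply: gens; rewrite inE ds orbT.
have [_ [T TG Tc]] := gens c (mem_head _ _).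
by exists (T + S); [exact: memvD | rewrite big_cons Ss Tc mulmxDr mulmxDl].
Qed.

(** The converse inclusion. The sum [f0] runs over ordered pairs, so each non-edge occurs twice,
    hence the factor 2; keeping only nonzero entries leaves generators of the ideal. *)
Lemma hess_act_ideal g S : S \in nonedge_space ->
  exists f, [/\ act_ideal g (graph_ideal G) f, f \is 2.-homog &
    hess f = 2%:R *: (g *m S *m g^T)].
Proof.
move=> /nonedge_spaceP[Sym S0].
pose f0 : R := \sum_(p | S p.1 p.2 != 0) S p.1 p.2 *: ('X_(p.1) * 'X_(p.2)).
exists (act g f0); split.
- exists f0 => //.
  exists [seq ((S p.1 p.2)%:MP, 'X_(p.1) * 'X_(p.2)) | p <- enum [pred p | S p.1 p.2 != 0]].
  split.
    move=> c /mapP[p]; rewrite mem_enum inE => Sp -> /=; left; exists p.1, p.2.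
    have : ~~ ((p.1 == p.2) || G p.1 p.2) by apply: contraNN Sp => /S0 ->.
    by rewrite negb_or => /andP[].
  rewrite big_map big_enum /=; apply: eq_bigr => p _.
  by rewrite mul_mpolyC.
- rewrite act_sum; apply: rpred_sum => p _; rewrite actZ; apply: rpredZ.
  by rewrite -mpolyXD -(mdeg_pair p); apply: actX_dhomog.
rewrite act_sum hess_sum.
pose F (T : 'M[K]_n) := g *m T *m g^T.
transitivity (F (\sum_p S p.1 p.2 *: (delta_mx p.1 p.2 + delta_mx p.2 p.1))).
  rewrite /F mulmx_sumr mulmx_suml big_mkcond; apply: eq_bigr => p _.
  rewrite actZ hessZ hess_actXX -scalemxAr -scalemxAl.
  by case: eqP => //= ->; rewrite !scale0r.
rewrite scalemxAl scalemxAr /F; congr (_ *m _ *m _).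
have sumS : \sum_p S p.1 p.2 *: delta_mx p.1 p.2 = S.
  by rewrite {2}[S]matrix_sum_delta pair_bigA.
rewrite (eq_bigr (fun p => S p.1 p.2 *: delta_mx p.1 p.2 +
  (S p.1 p.2 *: delta_mx p.1 p.2)^T)); last first.
  by move=> p _; rewrite scalerDr linearZ /= trmx_delta.
by rewrite big_split -(raddf_sum trmx) /= sumS Sym scaler_nat.
Qed.

Lemma pair_mnm_le p m : (mdeg m = 2)%N -> (m <= pair_mnm p)%MM -> m = pair_mnm p.
Proof.
move=> m2 le; rewrite -(submK le); suff /eqP -> : (pair_mnm p - m == 0)%MM by rewrite add0m.
have /(congr1 (@mdeg n)) := submK le.
by rewrite mdegD mdeg_pair m2 -mdeg_eq0 => /eqP; rewrite (eqn_add2r 2 _ 0).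
Qed.

Definition leading_pair g : pred ('I_n * 'I_n) :=
  leading (fun p => linfun (congr_entry g p)) (@lex_rank n) (ordered_pairs n) nonedge_space.

Lemma leading_pairP g p : reflect
  (p \in (ordered_pairs n) /\ exists S, [/\ S \in nonedge_space,
     (g *m S *m g^T) p.1 p.2 != 0 & forall q, q \in (ordered_pairs n) ->
     (lex_rank p < lex_rank q)%N -> (g *m S *m g^T) q.1 q.2 = 0])
  (leading_pair g p).
Proof.
apply: (iffP (leadingP _ _ _ _ _)) => -[pD [S [SG Sp Sq]]]; split=> //; exists S; split=> //.
- by move: Sp; rewrite lfunE.
- by move=> q qD /Sq; rewrite lfunE; apply.
- by rewrite lfunE.
by move=> q qD /Sq; rewrite lfunE; apply.
Qed.

(** Some generator of the initial ideal divides [pair_mnm p]; having degree at least two, it is this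
    monomial itself. *)
Lemma initial_ideal_mnm (I : R -> Prop) p :
    (forall f, I f -> order_ge2 f) ->
    initial_ideal I 'X_[pair_mnm p] ->
  exists f, I f /\ initial_monomial f (pair_mnm p).
Proof.
move=> I2 [s [sI /(congr1 (mcoeff (pair_mnm p)))]].
rewrite mcoeffX eqxx mcoeff_sum => sum1.
have [c cs cp] : exists2 c, c \in s & (c.1 * c.2)@_(pair_mnm p) != 0.
  apply/hasP; apply: contra_eqT sum1 => /hasPn s0.
  rewrite big_seq big1 ?oner_eq0 // => c cs; apply/eqP.
  by move: (s0 c cs); rewrite negbK.
have [f [m [If fm cE]]] := sI c cs.
exists f; split=> //; suff <- : m = pair_mnm p by [].
have le : (m <= pair_mnm p)%MM.
  move: cp; rewrite cE -mcoeff_msupp => /msuppM_le /allpairsP[[m1 m2] /= [_]].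
  by rewrite msuppX inE => /eqP -> ->; rewrite lem_addl.
apply: pair_mnm_le => //; apply/eqP; rewrite eqn_leq.
rewrite -{1}(mdeg_pair p) -{1}(submK le) mdegD leq_addl.
by apply: order_ge2_mdeg (I2 _ If) _; case: fm.
Qed.

Lemma natr2_neq0 : 2%:R != 0 :> K.
Proof. by rewrite (natr_eq0_char0 charK0). Qed.

Lemma hess_eq0 f p : (hess f p.1 p.2 == 0) = (f@_(pair_mnm p) == 0).
Proof. by rewrite hessE -mulr_natr mulf_eq0 (natr_eq0_char0 charK0) orbF. Qed.

(** For a quadric, the initial monomial is the pair of largest rank at which the Hessian is nonzero,
    and the Hessians are the matrices [g *m S *m g^T] up to a nonzero scalar. *)
Lemma initial_pairP g p : p \in (ordered_pairs n) ->
  initial_ideal (act_ideal g (graph_ideal G)) 'X_[pair_mnm p] <-> leading_pair g p.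
Proof.
move=> pD; split.
  case/initial_ideal_mnm=> [f /act_ideal_hess[] //|f [/act_ideal_hess[f2 [S SG fS]] [pf pmax]]].
  apply/leading_pairP; split=> //; exists S; split=> //.
    by rewrite -fS hess_eq0 -mcoeff_msupp.
  move=> q qD lt; apply/eqP; rewrite -fS hess_eq0 mcoeff_eq0; apply/negP => qf.
  have r := revlt_pair pD qD lt.
  have := revlt_asym r; rewrite pmax //.
  by apply: contraTneq lt => /(pair_mnm_inj qD pD) ->; rewrite ltnn.
case/leading_pairP=> _ [S [SG Sp Sq]].
have [f [If f2 fS]] := hess_act_ideal g SG.
exists [:: (1, 'X_[pair_mnm p])]; split; last by rewrite big_seq1 mul1r.
move=> _ /[!inE] /eqP -> /=; exists f, (pair_mnm p); split=> //; split.
  by rewrite mcoeff_msupp -hess_eq0 fS mxE mulf_neq0 // natr2_neq0.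
move=> m mf mp; have /mdeg2P[q qD mE] := dhomog_mf f2 mf.
rewrite mE in mf mp *; apply: revlt_pair => //.
case: (ltngtP (lex_rank q) (lex_rank p)) => // [lt|/lex_rank_inj qp]; last first.
  by rewrite qp eqxx in mp.
by move: mf; rewrite mcoeff_msupp -hess_eq0 fS mxE Sq ?mulr0 ?eqxx.
Qed.

(** Entries scale by [s ^+ 2]. This absorbs the scalar of [generic_zariski]. *)
Lemma leading_pairZ g s : s != 0 -> leading_pair (s *: g) =1 leading_pair g.
Proof.
move=> s0 p.
have E S q : (s *: g *m S *m (s *: g)^T) q.1 q.2 = s ^+ 2 * (g *m S *m g^T) q.1 q.2.
  by rewrite linearZ /= -scalemxAr -!scalemxAl scalerA mxE expr2.
apply/leading_pairP/leading_pairP => -[pD [S [SG Sp Sq]]]; split=> //; exists S; split=> //.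
- by move: Sp; rewrite E mulf_eq0 negb_or => /andP[].
- move=> q qD /(Sq q qD)/eqP; rewrite E mulf_eq0 expf_eq0 (negPf s0) /=.
  by move/eqP.
- by rewrite E mulf_neq0 ?expf_neq0.
by move=> q qD /(Sq q qD); rewrite E => ->; rewrite mulr0.
Qed.

End InitialIdeal.

(** * Quadrics through the rows of a matrix *)

Section VanishingQuadrics.
Local Open Scope ring_scope.
Variable K : fieldType.
Hypothesis charK0 : [pchar K] =i pred0.

Definition asym m (Q : 'M[K]_m) : 'M[K]_m := Q - Q^T.

Fact asym_is_linear m : linear (@asym m).
Proof. by move=> a Q T; rewrite /asym linearP scalerBr opprD addrACA. Qed.

HB.instance Definition _ m := GRing.isLinear.Build K 'M[K]_m 'M[K]_m _
  (@asym m) (@asym_is_linear m).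

Definition sym_space m : {vspace 'M[K]_m} := lker (linfun (@asym m)).

Lemma sym_spaceP m (Q : 'M[K]_m) : reflect (Q^T = Q) (Q \in sym_space m).
Proof.
by rewrite memv_ker lfunE /= subr_eq0 eq_sym; apply: eqP.
Qed.

Lemma sym_delta_neq0 m (p : 'I_m * 'I_m) :
  (delta_mx p.1 p.2 + delta_mx p.2 p.1 : 'M[K]_m) p.1 p.2 != 0.
Proof.
rewrite !mxE !eqxx /=; case: (eqVneq p.1 p.2) => [_|_] /=.
  by rewrite (natr_eq0_char0 charK0 2).
by rewrite addr0 oner_eq0.
Qed.

Lemma sym_delta_eq0 m (p q : 'I_m * 'I_m) :
    p \in ordered_pairs m -> q \in ordered_pairs m -> (lex_rank p < lex_rank q)%N ->
  (delta_mx p.1 p.2 + delta_mx p.2 p.1 : 'M[K]_m) q.1 q.2 = 0.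
Proof.
case: p q => [i j] [k l]; rewrite !inE /= => ij kl lt; rewrite !mxE.
case: (boolP ((k == i) && (l == j))) => [/andP[/eqP ki /eqP lj]|_].
  by rewrite ki lj ltnn in lt.
case: (boolP ((k == j) && (l == i))) => [/andP[/eqP kj /eqP li]|_]; last by rewrite addr0.
have e : i = j by apply/val_inj/eqP; rewrite eqn_leq ij -li -kj.
by rewrite kj li e ltnn in lt.
Qed.

(** Counted by leading positions for the identity matrix: symmetrized elementary matrices make every
    ordered pair leading. *)
Lemma dim_sym_space m : \dim (sym_space m) = #|ordered_pairs m|.
Proof.
pose c (p : 'I_m * 'I_m) := linfun (congr_entry (1%:M : 'M[K]_m) p).
have cE p Q : c p Q = Q p.1 p.2.
  by rewrite lfunE /= /congr_entry trmx1 mulmx1 mul1mx.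
have := dim_lead_below (c := c) (D := ordered_pairs m) (@lex_rank_inj m) (m * m)%N
  (_ : forall v, v \in sym_space m -> _).
have rlt (p : 'I_m * 'I_m) : (lex_rank p < m * m)%N.
  by rewrite ltnNge (lex_rank_ge p m) -ltnNge.
have -> : lead_below c (@lex_rank m) (ordered_pairs m) (sym_space m) (m * m) = sym_space m.
  apply/eqP; rewrite eqEsubv capvSl; apply/subvP => v vS; apply/lead_belowP.
  by split=> // q _; rewrite leqNgt rlt.
move=> -> => [|Q /sym_spaceP QS Q0]; last first.
  apply/matrixP=> i j; rewrite mxE; case: (leqP i j) => [ij|/ltnW ji].
    by rewrite -(Q0 (i, j)) ?inE // cE.
  by rewrite -QS mxE -(Q0 (j, i)) ?inE // cE.
apply: eq_card => p; rewrite inE rlt andbT; apply/leadingP/idP => [[] //|pD]; split=> //.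
exists (delta_mx p.1 p.2 + delta_mx p.2 p.1); split.
- by apply/sym_spaceP; rewrite linearD /= !trmx_delta addrC.
- by rewrite cE sym_delta_neq0.
by move=> q qD lt; rewrite cE (sym_delta_eq0 pD qD lt).
Qed.

Definition diag_values r m (H : 'M[K]_(r, m)) (Q : 'M[K]_m) : 'rV[K]_r :=
  \row_i (H *m Q *m H^T) i i.

Fact diag_values_is_linear r m (H : 'M[K]_(r, m)) : linear (diag_values H).
Proof.
move=> a Q T; apply/rowP=> i.
by rewrite mxE mulmxDr mulmxDl -scalemxAr -scalemxAl !mxE.
Qed.

HB.instance Definition _ r m H := GRing.isLinear.Build K 'M[K]_m 'rV[K]_r _
  (@diag_values r m H) (@diag_values_is_linear r m H).

Definition quadrics_through r m (H : 'M[K]_(r, m)) : {vspace 'M[K]_m} :=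
  (sym_space m :&: lker (linfun (diag_values H)))%VS.

Lemma quadrics_throughP r m (H : 'M[K]_(r, m)) Q :
  reflect (Q^T = Q /\ forall i, (H *m Q *m H^T) i i = 0) (Q \in quadrics_through H).
Proof.
apply: (iffP memv_capP) => -[]; rewrite memv_ker lfunE /=.
  by move=> /sym_spaceP QS /eqP/rowP Q0; split=> // i; move: (Q0 i); rewrite mxE [RHS]mxE.
by move=> /sym_spaceP QS Q0; split=> //; apply/eqP/rowP => i; rewrite mxE Q0 mxE.
Qed.

Lemma mulmx_delta_tr r m (H : 'M[K]_(r, m)) s t i j :
  (H *m delta_mx s t *m H^T) i j = H i s * H j t.
Proof.
rewrite -(mul_delta_mx (0 : 'I_1)) mulmxA -mulmxA -colE -rowE.
by rewrite mxE big_ord1 !mxE.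
Qed.

(** Evaluation matrix of [r] quadratic monomials at the [r] rows of [H]. When it is invertible,
    these points impose independent conditions on quadrics. *)
Definition pair_values r m (H : 'M[K]_(r, m)) (e : 'I_r -> 'I_m * 'I_m) : 'M[K]_r :=
  \matrix_(p, i) (H i (e p).1 * H i (e p).2).

Lemma dim_quadrics_unit r m (H : 'M[K]_(r, m)) e : pair_values H e \in unitmx ->
  \dim (quadrics_through H) = (#|ordered_pairs m| - r)%N.
Proof.
move=> uM; rewrite -dim_sym_space -(limg_ker_dim (linfun (diag_values H)) (sym_space m)).
suff -> : (linfun (diag_values H) @: sym_space m)%VS = fullv.
  by rewrite dimvf /dim /= mul1n addnK.
apply/eqP; rewrite eqEsubv subvf; apply/subvP => z _; apply/memv_imgP.
(* Interpolation of the values [z] by the chosen monomials. The coefficients are halved below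
   because a symmetrized elementary matrix evaluates to twice its monomial. *)
pose y := z *m invmx (pair_values H e).
pose Q := \sum_p (y 0 p / 2%:R) *: (delta_mx (e p).1 (e p).2 + delta_mx (e p).2 (e p).1).
exists Q.
  apply: memv_suml => p _; apply: memvZ; apply/sym_spaceP.
  by rewrite linearD /= !trmx_delta addrC.
rewrite -(mulmxKV uM z) -/y lfunE /= linear_sum /=; apply/rowP=> i.
rewrite [LHS]mxE summxE; apply: eq_bigr => p _.
rewrite linearZ /=; move: (y 0 p) => y0.
rewrite [RHS]mxE [X in _ = _ * X]mxE mulmxDr mulmxDl [X in _ = _ * X]mxE.
rewrite !mulmx_delta_tr mxE [H i (e p).2 * _]mulrC -mulr2n -[_ * _ *+ 2]mulr_natl mulrA.
by rewrite divfK // (natr_eq0_char0 charK0 2).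
Qed.

Lemma congr_rowsub n r m (f : 'I_r -> 'I_n) (H : 'M[K]_(n, m)) Q i j :
  (rowsub f H *m Q *m (rowsub f H)^T) i j = (H *m Q *m H^T) (f i) (f j).
Proof.
rewrite !mxE; apply: eq_bigr => k _; rewrite !mxE; congr (_ * _).
by apply: eq_bigr => l _; rewrite mxE.
Qed.

(** When there are more points than quadratic monomials, the first [#|ordered_pairs m|] rows already
    exclude every nonzero quadric, in accordance with the truncated subtraction. *)
Lemma dim_quadrics n m (H : 'M[K]_(n, m)) :
    (forall r (le_rn : (r <= n)%N), (r <= #|ordered_pairs m|)%N ->
       exists e, pair_values (rowsub (widen_ord le_rn) H) e \in unitmx) ->
  \dim (quadrics_through H) = (#|ordered_pairs m| - n)%N.
Proof.
move=> uH; case: (leqP n #|ordered_pairs m|) => [le|/ltnW le].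
  have [e] := uH n (leqnn n) le.
  rewrite (_ : rowsub _ H = H); first exact: dim_quadrics_unit.
  by apply/matrixP=> i j; rewrite mxE; congr (H _ _); apply: val_inj.
have [e /dim_quadrics_unit] := uH _ le (leqnn _).
rewrite subnn => d0; apply/eqP; rewrite (eqP (_ : _ - n == 0))%N ?subn_eq0 //.
rewrite -leqn0 -d0; apply/dimvS/subvP => Q /quadrics_throughP[QS Q0].
apply/quadrics_throughP; split=> // i.
by rewrite congr_rowsub.
Qed.

(** For each relevant [r], fix [r] pairs [e]: the determinant of [pair_values] is polynomial in the
    entries of [h], so one matrix at which it is nonzero suffices. *)
Lemma dim_quadrics_generic n m (le_mn : (m <= n)%N) :
  generic (fun h : 'M[K]_n =>
    \dim (quadrics_through (colsub (widen_ord le_mn) h)) = (#|ordered_pairs m| - n)%N).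
Proof.
pose w := widen_ord le_mn.
suff gr r : generic (fun h : 'M[K]_n => forall le_rn : (r <= n)%N,
    (r <= #|ordered_pairs m|)%N ->
     exists e, pair_values (rowsub (widen_ord le_rn) (colsub w h)) e \in unitmx).
  have := generic_forall charK0 (fun r : 'I_n.+1 => gr r).
  apply: generic_impl => h uh; apply: dim_quadrics => r le_rn.
  by have := uh (Ordinal (le_rn : (r < n.+1)%N)); apply.
have /orP[le_rn|gt] : (r <= n)%N || (n < r)%N by case: leqP.
  2: by apply: generic_always => h le; have := leq_trans gt le; rewrite ltnn.
have /orP[le_rN|gt] : (r <= #|ordered_pairs m|)%N || (#|ordered_pairs m| < r)%N.
  by case: leqP.
  2: by apply: generic_always => h ? /(leq_trans gt); rewrite ltnn.
pose e (p : 'I_r) : 'I_m * 'I_m := enum_val (widen_ord le_rN p).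
apply: (@generic_impl _ _ (fun h =>
    pair_values (rowsub (widen_ord le_rn) (colsub w h)) e \in unitmx)).
  move=> h u le_rn' _; exists e; congr (_ \in unitmx): u.
  by apply/matrixP => i j; rewrite !mxE; congr (h _ _ * h _ _); apply: val_inj.
pose M : 'M[{mpoly K[n * n]}]_r := \matrix_(p, i)
  (coordX K (widen_ord le_rn i) (w (e p).1) * coordX K (widen_ord le_rn i) (w (e p).2)).
apply: (generic_unitmx (M := M)) => [g p i|]; first by rewrite !mxE mevalM !coordXE.
(* With h_is = c_s ^ i, the products c_s c_t are the nodes of a Vandermonde
   matrix; they are distinct because 3 ^ s + 3 ^ t determines {s, t}. *)
pose c (s : nat) : nat := (2 ^ (3 ^ s))%N.
exists (\matrix_(i, s) (c s)%:R ^+ i).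
pose a : 'rV[K]_r := \row_p (c (e p).1 * c (e p).2)%:R.
have -> : pair_values (rowsub (widen_ord le_rn) (colsub w (\matrix_(i, s) (c s)%:R ^+ i))) e
    = (Vandermonde r a)^T.
  by apply/matrixP=> p i; rewrite !mxE natrM exprMn.
rewrite unitmx_tr unitmxE det_Vandermonde unitfE.
apply/prodf_neq0 => p _; apply/prodf_neq0 => q pq; rewrite !mxE subr_eq0.
apply: contraTneq pq => /(natr_inj_char0 charK0) eq_c; rewrite -leqNgt.
suff -> : p = q by [].
have eD x : e x \in ordered_pairs m by apply: enum_valP.
have: e p = e q; last by move=> /enum_val_inj/(congr1 val) /= /val_inj.
move: (eD p) (eD q) eq_c; case: (e p) (e q) => [s t] [s' t'] /=; rewrite !inE /=.
rewrite /c -!expnD => st st' /eqP; rewrite eqn_exp2l // => /eqP.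
(* The larger exponent decides, because [2 * 3 ^ y < 3 ^ y.+1]. *)
have lt3 x y (x' y' : nat) : (x <= y)%N -> (y < y')%N -> (3 ^ x + 3 ^ y < 3 ^ x' + 3 ^ y')%N.
  move=> xy yy'; apply: leq_trans (leq_addl _ _).
  apply: (@leq_trans (3 ^ y.+1)); last by rewrite leq_exp2l.
  have le3 : (3 ^ x <= 3 ^ y)%N by rewrite leq_exp2l.
  have : (0 < 3 ^ y)%N by rewrite expn_gt0.
  rewrite expnS; lia.
case: (ltngtP t t') => [tt'|tt'|/val_inj ->].
- by move=> e3; have := lt3 _ _ s' _ st tt'; rewrite e3 ltnn.
- by move=> e3; have := lt3 _ _ s _ st' tt'; rewrite e3 ltnn.
by move=> /eqP; rewrite eqn_add2r eqn_exp2l // => /eqP/val_inj ->.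
Qed.

End VanishingQuadrics.

(** * Stresses of the complete bipartite graph *)

Section Bipartite.
Local Open Scope ring_scope.
Variables (K : fieldType) (n : nat) (A : {set 'I_n}).
Hypothesis charK0 : [pchar K] =i pred0.
Local Notation G := (complete_bipartite A).
Local Notation stresses := (nonedge_space K G).

Variables (m : nat) (le_mn : (m <= n)%N) (h : 'M[K]_n).
Hypothesis uh : h \in unitmx.
Local Notation w := (widen_ord le_mn).
Local Notation H := (colsub w h).
Local Notation g := (invmx h).

Lemma bip_stressP (S : 'M[K]_n) : reflect
  [/\ S^T = S, forall i, S i i = 0 & forall i j, (i \in A) != (j \in A) -> S i j = 0]
  (S \in stresses).
Proof.
apply: (iffP (nonedge_spaceP _ _)) => [[SS S0]|[SS S0 Sc]]; split=> //.
- by move=> i; apply: S0; rewrite eqxx.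
- by move=> i j ij; apply: S0; rewrite /= /bip_adj ij orbT.
by move=> i j /orP[/eqP ->|/Sc].
Qed.

Lemma invmx_mul_colsub (i : 'I_n) s : (m <= i)%N -> (g *m H) i s = 0.
Proof.
move=> mi; rewrite mulmx_colsub mulVmx // !mxE; case: eqP => // e.
by move: mi; rewrite e leqNgt /= ltn_ord.
Qed.

Lemma colsub_mul_rowsub r (T : 'M[K]_(n, r)) : (forall (i : 'I_n) j, (m <= i)%N -> T i j = 0) ->
  h *m T = H *m rowsub w T.
Proof.
move=> T0; apply/matrixP=> i j; rewrite !mxE.
rewrite (bigID (fun k : 'I_n => (k < m)%N)) /= [X in _ + X]big1 ?addr0; last first.
  by move=> k; rewrite -leqNgt => /T0 ->; rewrite mulr0.
rewrite (big_ord_narrow le_mn) /=; apply: eq_bigr => s _; rewrite !mxE //.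
Qed.

(** After congruence by [g], split the matrix as [T' + T'^T] with [T'] supported on the first [m]
    rows, half of the upper left block going to each term. Then [h *m T'] involves only the columns
    in [H]. *)
Lemma vanishing_block_decomp (S : 'M[K]_n) : S^T = S ->
    (forall i j : 'I_n, (m <= i)%N -> (m <= j)%N -> (g *m S *m g^T) i j = 0) ->
  exists Y : 'M[K]_(m, n), S = H *m Y + (H *m Y)^T.
Proof.
move=> SS S0; pose T := g *m S *m g^T.
have TS : T^T = T by rewrite !trmx_mul trmxK SS mulmxA.
have TSE i j : T i j = T j i by rewrite -{1}TS mxE.
pose T' : 'M[K]_n := \matrix_(i, j)
  if (i < m)%N then (if (j < m)%N then T i j / 2%:R else T i j) else 0.
have T'0 (i : 'I_n) j : (m <= i)%N -> T' i j = 0 by rewrite mxE leqNgt => /negPf ->.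
have TE : T = T' + T'^T.
  apply/matrixP=> i j; rewrite [RHS]mxE [X in _ + X]mxE ![T' _ _]mxE (TSE j i).
  case: (ltnP i m) => im; case: (ltnP j m) => jm; rewrite ?add0r ?addr0 //.
    by rewrite -mulr2n -[_ / _ *+ 2]mulr_natr divfK // natr_eq0_char0.
  exact: S0.
exists (rowsub w T' *m h^T).
have -> : S = h *m T *m h^T.
  rewrite /T !mulmxA mulmxV // mul1mx -mulmxA -trmx_mul mulmxV //.
  by rewrite trmx1 mulmx1.
rewrite mulmxA -colsub_mul_rowsub // TE mulmxDr mulmxDl; congr (_ + _).
by rewrite !trmx_mul trmxK mulmxA.
Qed.

Definition side_sign : 'rV[K]_n := \row_i (if i \in A then 1 else - 1).

(** The entries of [H *m Q *m H^T] get multiplied by a sum of two signs: 2 within [A], -2 within its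
    complement, 0 across. The two-term form shows a factor [H] or [H^T] at an outer end of each
    term, which [g] kills in the lower right block. *)
Definition stress_of_quadric (Q : 'M[K]_m) : 'M[K]_n :=
  diag_mx side_sign *m (H *m Q *m H^T) + (H *m Q *m H^T) *m diag_mx side_sign.

Fact stress_of_quadric_is_linear : linear stress_of_quadric.
Proof.
move=> a Q T; rewrite /stress_of_quadric.
have -> : H *m (a *: Q + T) *m H^T = a *: (H *m Q *m H^T) + H *m T *m H^T.
  by rewrite mulmxDr mulmxDl -scalemxAr -scalemxAl.
by rewrite mulmxDr mulmxDl -scalemxAr -scalemxAl scalerDr addrACA.
Qed.

HB.instance Definition _ := GRing.isLinear.Build K 'M[K]_m 'M[K]_n _
  stress_of_quadric stress_of_quadric_is_linear.

Lemma stress_of_quadricE Q i j : stress_of_quadric Q i j =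
  (side_sign 0 i + side_sign 0 j) * (H *m Q *m H^T) i j.
Proof.
rewrite /stress_of_quadric mxE mul_diag_mx mul_mx_diag.
by rewrite [X in X + _]mxE [X in _ + X]mxE mulrDl; congr (_ + _); rewrite mulrC.
Qed.

Lemma stress_of_quadric_block Q (i j : 'I_n) : (m <= i)%N -> (m <= j)%N ->
  (g *m stress_of_quadric Q *m g^T) i j = 0.
Proof.
move=> mi mj; rewrite /stress_of_quadric mulmxDr mulmxDl mxE.
have z1 (X : 'M[K]_(n, m)) : (X *m (g *m H)^T) i j = 0.
  by rewrite mxE big1 // => s _; rewrite mxE invmx_mul_colsub // mulr0.
have z2 (X : 'M[K]_(m, n)) : (g *m H *m X) i j = 0.
  by rewrite mxE big1 // => s _; rewrite invmx_mul_colsub // mul0r.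
have -> : g *m (diag_mx side_sign *m (H *m Q *m H^T)) *m g^T
   = g *m diag_mx side_sign *m H *m Q *m (g *m H)^T.
  by rewrite trmx_mul !mulmxA.
have -> : g *m (H *m Q *m H^T *m diag_mx side_sign) *m g^T
   = g *m H *m (Q *m H^T *m diag_mx side_sign *m g^T).
  by rewrite !mulmxA.
by rewrite z1 z2 addr0.
Qed.

Variables (fA fB : 'I_m -> 'I_n).
Hypotheses (fA_in : forall s, fA s \in A) (fB_notin : forall s, fB s \notin A).
Hypotheses (uA : mxsub fA w h \in unitmx) (uB : mxsub fB w h \in unitmx).

(** On the rows [fA] both signs are 1, and the invertible block of [H] cancels on both sides. *)
Lemma stress_of_quadric_inj Q : stress_of_quadric Q = 0 -> Q = 0.
Proof.
move=> Q0; have HA : mxsub fA w h = rowsub fA H by apply/matrixP=> i j; rewrite !mxE.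
have : mxsub fA w h *m Q *m (mxsub fA w h)^T = 0.
  apply/matrixP=> s t; rewrite HA congr_rowsub [RHS]mxE.
  move/matrixP/(_ (fA s) (fA t)): Q0; rewrite stress_of_quadricE [RHS]mxE !mxE !fA_in.
  by move/eqP; rewrite mulf_eq0 (natr_eq0_char0 charK0 2) => /eqP.
move/(congr1 (fun X => invmx (mxsub fA w h) *m X *m invmx (mxsub fA w h)^T)).
by rewrite -mulmxA mulmxK ?unitmx_tr // mulKmx // mulmx0 mul0mx.
Qed.

(** Write [S] as [H *m Y + (H *m Y)^T]. Vanishing across the sides expresses all columns of [Y]
    through one matrix [C], so on either side [S] is, up to sign, the same symmetric form in the
    rows of [H]; the zero diagonal says that these rows lie on the quadric. *)
Lemma quadric_of_stress (S : 'M[K]_n) : S \in stresses ->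
    (forall i j : 'I_n, (m <= i)%N -> (m <= j)%N -> (g *m S *m g^T) i j = 0) ->
  exists2 Q, Q \in quadrics_through H & S = stress_of_quadric Q.
Proof.
case/bip_stressP=> SS Sd Sc S0; have [Y SY] := vanishing_block_decomp SS S0.
have SE i j : S i j = (row i H *m col j Y + row j H *m col i Y) 0 0.
  rewrite SY !mxE; congr (_ + _); apply: eq_bigr => s _; rewrite !mxE //.
pose bf (M : 'M[K]_m) i j := (H *m M *m H^T) i j.
have bfE M i j : (row i H *m (M *m (row j H)^T)) 0 0 = bf M i j.
  rewrite /bf mulmxA -row_mul [LHS]mxE [RHS]mxE; apply: eq_bigr => s _.
  by congr (_ * _); rewrite !mxE.
have bfT M i j : bf M^T i j = bf M j i.
  rewrite /bf (_ : H *m M^T *m H^T = (H *m M *m H^T)^T); first by rewrite mxE.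
  by rewrite !trmx_mul trmxK mulmxA.
(* The vanishing of S between the two sides forces Y to be C H^T on the columns
   outside A and - C^T H^T on those in A. *)
pose C := - (invmx (mxsub fA w h) *m (colsub fA Y)^T).
have YB j : j \notin A -> col j Y = C *m (row j H)^T.
  move=> jA; apply: (can_inj (mulKmx uA)); rewrite /C mulNmx mulmxN !mulmxA mulmxV // mul1mx.
  apply/matrixP=> s z; rewrite (ord1 z) {z}.
  have := Sc (fA s) j; rewrite fA_in (negPf jA) SE mxE => /(_ isT) /eqP.
  rewrite addr_eq0 => /eqP e.
  transitivity ((row (fA s) H *m col j Y) 0 0).
    by rewrite !mxE; apply: eq_bigr => t _; rewrite !mxE.
  rewrite e !mxE; congr (- _); apply: eq_bigr => t _; rewrite !mxE mulrC //.
clearbody C.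
have YA i : i \in A -> col i Y = - C^T *m (row i H)^T.
  move=> iA; apply: (can_inj (mulKmx uB)); apply/matrixP=> s z; rewrite (ord1 z) {z}.
  have := Sc i (fB s); rewrite iA (negPf (fB_notin s)) SE mxE addrC => /(_ isT) /eqP.
  rewrite addr_eq0 => /eqP e.
  transitivity ((row (fB s) H *m col i Y) 0 0).
    by rewrite !mxE; apply: eq_bigr => t _; rewrite !mxE.
  rewrite e YB // mulNmx mulmxN [RHS]mxE; congr (- _).
  rewrite bfE -bfT -bfE [LHS]mxE [RHS]mxE; apply: eq_bigr => t _.
  by congr (_ * _); rewrite !mxE.
have bfD M N i j : bf (M + N) i j = bf M i j + bf N i j.
  by rewrite /bf mulmxDr mulmxDl mxE.
have bfN M i j : bf (- M) i j = - bf M i j.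
  by rewrite /bf mulmxN mulNmx mxE.
have bfZ c M i j : bf (c *: M) i j = c * bf M i j.
  by rewrite /bf -scalemxAr -scalemxAl mxE.
(* Outside [A] the form is [C + C^T] and the sign sum is -2; inside [A] both are negated. *)
pose Q := - (2%:R^-1 *: (C + C^T)).
have QE : S = stress_of_quadric Q.
  apply/matrixP=> i j; rewrite stress_of_quadricE -/(bf _ _ _) /Q bfN bfZ bfD bfT !mxE.
  have two0 : 2%:R != 0 :> K by rewrite natr_eq0_char0.
  case: (boolP (i \in A)) => iA; case: (boolP (j \in A)) => jA.
  - rewrite SE YA // YA // mxE !bfE !bfN !bfT. by field.
  - by rewrite subrr mul0r Sc // iA (negPf jA).
  - by rewrite addNr mul0r Sc // jA (negPf iA).
  rewrite SE YB // YB // mxE !bfE. by field.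
exists Q => //; apply/quadrics_throughP; split.
  by rewrite /Q linearN linearZ linearD /= trmxK addrC.
move=> i; have := Sd i; rewrite QE stress_of_quadricE => /eqP.
rewrite mulf_eq0 => /orP[|/eqP //]; rewrite !mxE.
have two0 : 2%:R != 0 :> K by rewrite natr_eq0_char0.
by case: ifP => _; rewrite -?opprD ?oppr_eq0 -[1 + 1]/(2%:R) (negPf two0).
Qed.

Lemma dim_lead_below_bip :
  \dim (lead_below (fun p => linfun (congr_entry g p)) (@lex_rank n)
          (ordered_pairs n) stresses (m * n)) = \dim (quadrics_through H).
Proof.
rewrite -(@limg_dim_eq _ _ _ (linfun stress_of_quadric)); last first.
  apply/eqP; rewrite -subv0; apply/subvP => Q /memv_capP[_].
  by rewrite memv_ker lfunE memv0 => /eqP /stress_of_quadric_inj ->.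
congr (\dim _); apply/eqP; rewrite eqEsubv; apply/andP; split; apply/subvP => S.
  case/lead_belowP=> SG Sq.
  have /bip_stressP[SS _ _] := SG.
  have [|Q QZ ->] := quadric_of_stress SG; last first.
    by apply/memv_imgP; exists Q; rewrite ?lfunE.
  move=> i j mi mj; case: (leqP i j) => [ij|/ltnW ji].
    by have := Sq (i, j); rewrite inE lfunE lex_rank_ge; apply.
  have := Sq (j, i); rewrite inE lfunE lex_rank_ge => /(_ ji mj) /= <-.
  have TS : (g *m S *m g^T)^T = g *m S *m g^T by rewrite !trmx_mul trmxK SS mulmxA.
  by rewrite /congr_entry /= -{1}TS mxE.
case/memv_imgP=> Q /quadrics_throughP[QS Q0] ->; rewrite lfunE /=.
apply/lead_belowP; split; last first.
  move=> q; rewrite inE lex_rank_ge lfunE => q12 mq; apply: stress_of_quadric_block => //.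
  exact: leq_trans mq q12.
have QSE i j : (H *m Q *m H^T) i j = (H *m Q *m H^T) j i.
  rewrite -[in RHS]QS (_ : H *m Q^T *m H^T = (H *m Q *m H^T)^T); first by rewrite [RHS]mxE.
  by rewrite !trmx_mul trmxK mulmxA.
apply/bip_stressP; split.
- by apply/matrixP=> i j; rewrite mxE !stress_of_quadricE addrC QSE.
- by move=> i; rewrite stress_of_quadricE Q0 mulr0.
move=> i j ij; rewrite stress_of_quadricE !mxE.
by move: ij; do 2!case: (_ \in A) => //; rewrite ?addNr ?subrr mul0r.
Qed.

End Bipartite.

(** * Coordinates in general position *)

Section GenericCoordinates.
Local Open Scope ring_scope.
Variables (K : fieldType) (n : nat).
Hypothesis charK0 : [pchar K] =i pred0.

(** All column counts are treated at once, so that a single [h] serves every [m] used below. *)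
Definition in_general_position (h : 'M[K]_n) : Prop :=
  forall r (le_rn : (r <= n)%N),
    \dim (quadrics_through (colsub (widen_ord le_rn) h)) = (#|ordered_pairs r| - n)%N /\
    forall f : 'I_r -> 'I_n, injective f -> mxsub f (widen_ord le_rn) h \in unitmx.

Lemma generic_general_position : generic in_general_position.
Proof.
(* Bounded [r] and finite functions leave finitely many conditions, as [generic_forall] requires. *)
suff gr (r : 'I_n.+1) : generic (fun h : 'M[K]_n => forall le_rn : (r <= n)%N,
    \dim (quadrics_through (colsub (widen_ord le_rn) h)) = (#|ordered_pairs r| - n)%N /\
    forall f : {ffun 'I_r -> 'I_n}, injectiveb f -> mxsub f (widen_ord le_rn) h \in unitmx).
  apply: generic_impl (generic_forall charK0 gr) => h hP r le_rn.
  have [dimr minr] := hP (Ordinal (le_rn : (r < n.+1)%N)) le_rn.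
  split=> // f finj; rewrite (_ : mxsub f _ h = mxsub (finfun f) (widen_ord le_rn) h).
    by apply/minr/injectiveP => i j; rewrite !ffunE => /finj.
  by apply/matrixP=> i j; rewrite !mxE ffunE.
have le_rn0 : (r <= n)%N by rewrite -ltnS.
have gm : generic (fun h : 'M[K]_n => forall f : {ffun 'I_r -> 'I_n},
    injectiveb f -> mxsub f (widen_ord le_rn0) h \in unitmx).
  apply: generic_forall => // f; case: (boolP (injectiveb f)) => finj.
    apply: generic_impl (generic_minor _ (injectiveP _ finj)
      (_ : injective (widen_ord le_rn0))) => //.
    by move=> i j /(congr1 val) /= /val_inj.
  exact: generic_always.
apply: generic_impl (generic_and charK0 (dim_quadrics_generic charK0 le_rn0) gm) => h [d1 d2] le_rn.
by rewrite (bool_irrelevance le_rn le_rn0).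
Qed.

End GenericCoordinates.

(** * Leading pairs with large first index *)

Section BipartiteLeading.
Local Open Scope ring_scope.
Variables (K : fieldType) (n : nat) (A : {set 'I_n}).
Hypothesis charK0 : [pchar K] =i pred0.
Local Notation G := (complete_bipartite A).
Local Notation stresses := (nonedge_space K G).

(** The rows of [H] indexed by [~: A] and one vertex of [A] form a basis, so a vector with
    prescribed products with them exists. This freedom corrects the matrix of a quadric into a
    stress without changing its lower right block. *)
Lemma leading_pair_last (h : 'M[K]_n) (p : 'I_n * 'I_n) :
    h \in unitmx -> in_general_position h -> A != set0 ->
    p \in ordered_pairs n -> (#|~: A|.+1 <= p.1)%N ->
  leading_pair G (invmx h) p.
Proof.
move=> uh hP A0 pD; set r := #|~: A|.+1 => rp.
have le_rn : (r <= n)%N.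
  by rewrite -[X in (_ <= X)%N]card_ord -(cardsC A) /r -add1n leq_add2r card_gt0.
pose w := widen_ord le_rn; pose H := colsub w h; pose g := invmx h.
have solve i (z : 'I_n -> K) : i \in A ->
    exists y : 'cV[K]_r, forall k, (k == i) || (k \notin A) -> (row k H *m y) 0 0 = z k.
  move=> iA; have cardC : #|i |: ~: A| = r by rewrite cardsU1 inE iA.
  pose f s := enum_val (cast_ord (esym cardC) s).
  have finj : injective f by move=> s t /enum_val_inj/cast_ord_inj.
  have [_ /(_ f finj) uf] := hP r le_rn.
  exists (invmx (mxsub f w h) *m \col_s z (f s)) => k kC.
  have kin : k \in i |: ~: A by rewrite !inE.
  pose s := cast_ord cardC (enum_rank_in kin k).
  have fs : f s = k by rewrite /f /s cast_ordK enum_rankK_in.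
  have -> : row k H = row s (mxsub f w h) by apply/rowP=> j; rewrite !mxE fs.
  by rewrite -row_mul mulKVmx // !mxE fs.
pose M : 'M[K]_n := h *m (delta_mx p.1 p.2 + delta_mx p.2 p.1) *m h^T.
have MS k l : M k l = M l k.
  have MT : M^T = M.
    by rewrite /M !trmx_mul trmxK linearD /= !trmx_delta mulmxA [X in _ *m X *m _]addrC.
  by rewrite -{1}MT mxE.
have two0 : 2%:R != 0 :> K by rewrite natr_eq0_char0.
have [i0 i0A] : exists i, i \in A by apply/set0Pn.
(* Columns outside [A] are chosen first, to cancel only their diagonal entries. Those in [A] then
   cancel their diagonal entries and all entries across the sides. *)
have /fin_all_exists[yB yBP] (k : 'I_n) : exists y : 'cV[K]_r,
    k \notin A -> (row k H *m y) 0 0 = M k k / 2%:R.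
  have [y yP] := solve i0 (fun=> M k k / 2%:R) i0A.
  by exists y => kA; apply: yP; rewrite kA orbT.
have /fin_all_exists[yA yAP] (i : 'I_n) : exists y : 'cV[K]_r, i \in A ->
    (row i H *m y) 0 0 = M i i / 2%:R /\
    forall k, k \notin A -> (row k H *m y) 0 0 = M i k - (row i H *m yB k) 0 0.
  case: (boolP (i \in A)) => iA; last by exists 0.
  have [y yP] := solve i (fun k => if k == i then M i i / 2%:R else
    M i k - (row i H *m yB k) 0 0) iA.
  exists y => _; split=> [|k kA]; first by rewrite yP eqxx.
  by rewrite yP ?kA ?orbT //; case: eqP kA => // ->; rewrite iA.
pose Y : 'M[K]_(r, n) := \matrix_(s, k) (if k \in A then yA k else yB k) s 0.
have HYE l k : (H *m Y) l k = (row l H *m (if k \in A then yA k else yB k)) 0 0.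
  by rewrite !mxE; apply: eq_bigr => s _; rewrite !mxE.
pose S := M - (H *m Y + (H *m Y)^T).
have SE k l : S k l = M k l - ((H *m Y) k l + (H *m Y) l k).
  by rewrite /S !mxE.
have SG : S \in stresses.
  have half (x : K) : x - (x / 2%:R + x / 2%:R) = 0 by field.
  have cross i k : i \in A -> k \notin A -> S i k = 0.
    move=> iA kA; rewrite SE !HYE iA (negPf kA) (yAP i iA).2 //.
    by ring.
  apply/bip_stressP; split.
  - by apply/matrixP=> k l; rewrite mxE !SE MS [X in _ - X]addrC.
  - by move=> k; rewrite SE HYE; case: ifP => [/yAP[-> _]|/negbT/yBP ->]; apply: half.
  move=> k l; case: (boolP (k \in A)) => kA; case: (boolP (l \in A)) => lA // _.
    exact: cross.
  by rewrite SE MS [X in _ - X]addrC -SE cross.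
have gHY (k l : 'I_n) : (r <= k)%N -> (g *m (H *m Y) *m g^T) k l = 0.
  move=> rk; rewrite mulmxA -mulmxA mxE big1 // => s _.
  by rewrite (invmx_mul_colsub le_rn uh) // mul0r.
(* The correction has no entry in the block of indices at least [r], which contains [p] and every
   ordered pair of larger rank. *)
have gSg (k l : 'I_n) : (r <= k)%N -> (r <= l)%N ->
    (g *m S *m g^T) k l = (delta_mx p.1 p.2 + delta_mx p.2 p.1 : 'M[K]_n) k l.
  move=> rk rl.
  have -> : g *m S *m g^T = (delta_mx p.1 p.2 + delta_mx p.2 p.1) -
      (g *m (H *m Y) *m g^T + (g *m (H *m Y) *m g^T)^T).
    rewrite /S mulmxBr mulmxBl mulmxDr mulmxDl; congr (_ - (_ + _)).
      by rewrite /M !mulmxA mulVmx // mul1mx -mulmxA -trmx_mul mulVmx // trmx1 mulmx1.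
    by rewrite !trmx_mul trmxK !mulmxA.
  rewrite mxE [X in _ + X]mxE [X in _ - X]mxE [X in _ - (_ + X)]mxE !gHY //.
  by rewrite addr0 subr0.
have rp2 : (r <= p.2)%N by apply: leq_trans rp _; move: pD; rewrite inE.
apply/leading_pairP; split=> //; exists S; split=> //.
  by rewrite gSg // sym_delta_neq0.
move=> q qD lt.
have rq : (r <= q.1)%N.
  by case: (lex_rank_lt lt) => [/ltnW|[<- _]]; first exact: leq_trans.
have rq2 : (r <= q.2)%N by apply: leq_trans rq _; move: qD; rewrite inE.
by rewrite gSg // (sym_delta_eq0 _ pD qD lt).
Qed.

End BipartiteLeading.

(** * Counting *)

Lemma bin2_addn x y : 'C(x + y, 2) = 'C(x, 2) + 'C(y, 2) + x * y.
Proof.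
elim: x => [|x IHx]; first by rewrite add0n mul0n addn0.
by rewrite addSn !binS !bin1 IHx; lia.
Qed.

Lemma bin2_square n : 'C(n.+1, 2) + 'C(n, 2) = n * n.
Proof. by elim: n => [|n IHn] //; rewrite binS bin1; move: IHn; rewrite binS bin1; lia. Qed.

Lemma card_ord_ge n m : m <= n -> #|[set j : 'I_n | m <= j]| = n - m.
Proof.
move=> mn; have := cardsC [set j : 'I_n | m <= j]; rewrite card_ord.
suff -> : #|~: [set j : 'I_n | m <= j]| = m by lia.
rewrite -[RHS]card_ord -sum1_card -[RHS]sum1_card -(@big_ord_narrow _ _ _ _ _ (fun=> 1) mn).
by apply: eq_bigl => j; rewrite !inE -ltnNge.
Qed.

(** Row [i] contributes [n - i] pairs; the additive form avoids truncated subtraction. *)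
Lemma card_ordered_pairs_below n m : m <= n ->
  #|[set p in ordered_pairs n | p.1 < m]| + 'C(m, 2) = m * n.
Proof.
elim: m => [|m IHm] mn.
  by rewrite (_ : [set _ in _ | _] = set0) ?cards0 //; apply/setP=> p; rewrite !inE andbF.
pose i0 := Ordinal mn.
have -> : [set p in ordered_pairs n | p.1 < m.+1] =
    [set p in ordered_pairs n | p.1 < m] :|: pair i0 @: [set j : 'I_n | m <= j].
  apply/setP=> -[i j]; rewrite !inE /= ltnS [i <= m]leq_eqVlt andb_orr orbC.
  congr (_ || _); apply/andP/imsetP => [[ij /eqP im]|[k]].
    by exists j; rewrite ?inE -?im //; congr pair; apply: val_inj.
  by rewrite inE => mk [-> ->]; rewrite /= eqxx.
rewrite cardsU (_ : _ :&: _ = set0) ?cards0 ?subn0; last first.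
  apply/setP=> -[i j]; rewrite !inE; apply/andP => -[/andP[_ im] /imsetP[k _ [ii0 _]]].
  by rewrite ii0 ltnn in im.
rewrite card_imset ?card_ord_ge ?(ltnW mn) //; last by move=> x y [].
by have := IHm (ltnW mn); rewrite binS bin1; lia.
Qed.

Lemma card_ordered_pairs n : #|ordered_pairs n| = 'C(n.+1, 2).
Proof.
have := card_ordered_pairs_below (leqnn n); rewrite (_ : [set p in _ | _] = ordered_pairs n).
  by have := bin2_square n; lia.
by apply/setP=> p; rewrite !inE ltn_ord andbT.
Qed.

Lemma card_cross_pairs n (A : {set 'I_n}) :
  #|[set p in ordered_pairs n | (p.1 \in A) != (p.2 \in A)]| = #|A| * #|~: A|.
Proof.
rewrite -cardsX; pose f (p : 'I_n * 'I_n) := if p.1 \in A then p else (p.2, p.1).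
rewrite -(card_in_imset (f := f)).
  apply: eq_card => -[i j]; rewrite !inE /=; apply/imsetP/andP => [[[k l]]|[iA jA]].
    rewrite !inE /= => /andP[kl kAl]; rewrite /f /=.
    by move: kAl; case: ifP => kA; case: (boolP (l \in A)) => // lA _ [-> ->]; rewrite ?kA ?lA.
  case: (leqP i j) => [ij|/ltnW ji].
    by exists (i, j); rewrite ?inE /f /= ?ij iA // (negPf jA).
  by exists (j, i); rewrite ?inE /f /= ?ji (negPf jA) // iA.
have swap (i j : 'I_n) : i <= j -> j <= i -> (i \in A) = (j \in A).
  by move=> ij ji; congr (_ \in A); apply/val_inj/eqP; rewrite eqn_leq ij.
move=> [i j] [k l]; rewrite !inE /= => /andP[ij iAj] /andP[kl kAl]; rewrite /f /=.
case: (i \in A) iAj (swap i j) => iAj sw; case: (k \in A) kAl => kAl // -[ik jl].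
- by move: sw iAj; rewrite ij ik jl kl => <-.
- by have ji : j <= i by [rewrite ik jl]; rewrite -(sw ij ji) in iAj.
by rewrite ik jl.
Qed.

(** * Numbers of non-leading pairs *)

Section Nonleading.
Variables (K : fieldType) (n : nat) (A : {set 'I_n}).
Hypothesis charK0 : [pchar K]%R =i pred0.
Local Notation G := (complete_bipartite A).
Implicit Types (g h : 'M[K]_n) (m : nat).

Definition nonleading g m : {set 'I_n * 'I_n} :=
  [set p in ordered_pairs n | (p.1 < m) && ~~ leading_pair G g p].

Lemma lex_rank_lt_mul m (p : 'I_n * 'I_n) : (lex_rank p < m * n) = (p.1 < m).
Proof. by rewrite ltnNge lex_rank_ge -ltnNge. Qed.

(** The dimension counts the leading pairs with first index below [m]; congruence by an invertible
    matrix is injective, so the entries determine the stress. *)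
Lemma card_nonleading g m : g \in unitmx ->
  #|nonleading g m| + \dim (lead_below (fun p => linfun (congr_entry g p))
     (@lex_rank n) (ordered_pairs n) (nonedge_space K G) (m * n)) =
  #|[set p in ordered_pairs n | p.1 < m]|.
Proof.
move=> ug; rewrite dim_lead_below; first last.
- move=> S /nonedge_spaceP[SS _] S0.
  have T0 : (g *m S *m g^T = 0)%R.
    have TS : ((g *m S *m g^T)^T = g *m S *m g^T)%R.
      by rewrite !trmx_mul trmxK SS mulmxA.
    apply/matrixP=> i j; rewrite [RHS]mxE; case: (leqP i j) => [ij|/ltnW ji].
      by have := S0 (i, j); rewrite inE lfunE; apply.
    by have := S0 (j, i); rewrite inE lfunE => /(_ ji) /= T0; rewrite -TS mxE.
  move/(congr1 (fun X => invmx g *m X *m invmx g^T)%R): T0.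
  by rewrite -mulmxA mulmxK ?unitmx_tr // mulKmx // mulmx0 mul0mx.
- exact: lex_rank_inj.
rewrite -(cardsID [set p | ~~ leading_pair G g p] [set p in ordered_pairs n | p.1 < m]).
congr (_ + _); apply: eq_card => p; rewrite !inE ?negbK ?andbA //.
rewrite lex_rank_lt_mul -/(leading_pair G g p).
by case: (boolP (leading_pair G g p)) => //= /leading_pairP[]; rewrite inE => -> _.
Qed.

Lemma leading_pair1 p : leading_pair G (1%:M : 'M[K]_n)%R p =
  (p \in ordered_pairs n) && ~~ ((p.1 == p.2) || ((p.1 \in A) != (p.2 \in A))).
Proof.
apply/leading_pairP/andP => -[pD].
  move=> [S [/nonedge_spaceP[_ S0]]]; rewrite trmx1 mulmx1 mul1mx => Sp _; split=> //.
  by apply: contraNN Sp => /S0 ->.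
move=> np; split=> //; exists (delta_mx p.1 p.2 + delta_mx p.2 p.1)%R.
rewrite trmx1 mulmx1 mul1mx; split; last 2 first.
- exact: sym_delta_neq0.
- by move=> q qD lt; rewrite (sym_delta_eq0 _ pD qD lt).
apply/nonedge_spaceP; split; first by rewrite linearD /= !trmx_delta addrC.
move=> k l kl; rewrite !mxE.
have E a b : ~~ ((a == b) || G a b) -> (k == a) && (l == b) = false.
  by move=> nab; apply/andP => -[/eqP ka /eqP lb]; rewrite ka lb (negPf nab) in kl.
have np' : ~~ ((p.2 == p.1) || G p.2 p.1) by rewrite eq_sym adj_sym.
by rewrite (E _ _ np) (E _ _ np') addr0.
Qed.

(** At [m = n] the filtration has reached the whole space, so the count is the same for every
    invertible [g]. For the identity, the non-leading pairs are the diagonal ones and the edges. *)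
Lemma card_nonleading_all g : g \in unitmx -> #|nonleading g n| = n + #|A| * #|~: A|.
Proof.
move=> ug.
have dimE g' : lead_below (fun p => linfun (congr_entry g' p))
     (@lex_rank n) (ordered_pairs n) (nonedge_space K G) (n * n) = nonedge_space K G.
  apply/eqP; rewrite eqEsubv capvSl; apply/subvP => v vS; apply/lead_belowP.
  by split=> // q _; rewrite leqNgt lex_rank_lt_mul ltn_ord.
have -> : #|nonleading g n| = #|nonleading 1%:M n|.
  have := card_nonleading n ug; have := card_nonleading n (unitmx1 K n).
  by rewrite !dimE => <- /addIn.
rewrite (_ : nonleading _ n = [set (i, i) | i in 'I_n] :|:
   [set p in ordered_pairs n | (p.1 \in A) != (p.2 \in A)]).
  rewrite cardsU (_ : _ :&: _ = set0) ?cards0 ?subn0; last first.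
    apply/setP=> p; rewrite !inE; apply/andP => -[/imsetP[i _ ->]] /=.
    by rewrite eqxx andbF.
  by rewrite card_cross_pairs card_imset ?card_ord // => i j [].
apply/setP=> -[i j]; rewrite !inE leading_pair1 !inE /= ltn_ord /=.
rewrite negb_and negbK.
case: (leqP i j) => [ij|ji] /=.
  by congr (_ || _); apply/eqP/imsetP => [->|[k _ [-> ->]] //]; exists j.
by rewrite orbF; apply/esym/imsetP => -[k _ [ik jk]]; rewrite ik jk ltnn in ji.
Qed.

End Nonleading.

(** * From the generic initial ideal to the shifted graph *)

Section GenericInitialIdeal.
Variables (K : fieldType) (n : nat) (A : {set 'I_n}).
Hypothesis charK0 : [pchar K]%R =i pred0.
Local Notation G := (complete_bipartite A).
Implicit Types (J : {mpoly K[n]} -> Prop) (g h : 'M[K]_n) (m : nat).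

(** The truncated difference is the dimension of the quadrics through the rows of the first [m]
    columns; the bounds on [m] provide the [m] vertices needed on each side. *)
Lemma card_nonleading_small h m :
    h \in unitmx -> in_general_position h -> m <= #|A| -> m <= #|~: A| ->
  #|nonleading A (invmx h) m| + ('C(m.+1, 2) - n) + 'C(m, 2) = m * n.
Proof.
move=> uh hP mA mB.
have le_mn : m <= n by apply: leq_trans mA _; rewrite -[X in _ <= X]card_ord max_card.
have inj_in (C : {set 'I_n}) (mC : m <= #|C|) :
    exists f : 'I_m -> 'I_n, injective f /\ forall s, f s \in C.
  exists (fun s => enum_val (widen_ord mC s)); split=> [s t /enum_val_inj|s].
    by move=> /(congr1 val) /= /val_inj.
  exact: enum_valP.
have [fA [fA_inj fA_in]] := inj_in A mA.
have [fB [fB_inj fB_in]] := inj_in (~: A) mB.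
have fB_notin s : fB s \notin A by have := fB_in s; rewrite inE.
have [dimQ minor] := hP m le_mn.
have uA := minor fA fA_inj; have uB := minor fB fB_inj.
rewrite -(card_ordered_pairs_below le_mn).
rewrite -(card_nonleading A m (_ : invmx h \in unitmx)) ?unitmx_inv //.
by rewrite (dim_lead_below_bip charK0 uh fA_in fB_notin uA uB) dimQ card_ordered_pairs.
Qed.

Lemma card_nonleading_large h m :
    h \in unitmx -> in_general_position h -> A != set0 -> #|~: A| < m -> m <= n ->
  #|nonleading A (invmx h) m| = n + #|A| * #|~: A|.
Proof.
move=> uh hP A0 Bm mn.
rewrite -(card_nonleading_all A charK0 (_ : invmx h \in unitmx)) ?unitmx_inv //.
apply: eq_card => p; rewrite inE [RHS]inE ltn_ord andTb.
case: (boolP (p \in ordered_pairs n)) => //= pD; case: (ltnP p.1 m) => //= mp.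
by rewrite leading_pair_last // (leq_trans Bm).
Qed.

Lemma GIN_pairP J g (p : 'I_n * 'I_n) :
    (forall q, q \in ordered_pairs n -> J 'X_[pair_mnm q]%R <-> leading_pair G g q) ->
    p \in ordered_pairs n ->
  GIN J (pair_mnm p) <-> ~~ leading_pair G g p.
Proof.
move=> JP pD; rewrite /GIN (JP p pD); split=> [[_ /negP //]|/negP np]; split=> //.
by exists p.1, p.2; move: pD; rewrite inE.
Qed.

(** Edges arise from non-leading pairs with [0 < p.1 <= k] by lowering the first index, while pairs
    with first index 0 give no edge. The smaller end [p.1.-1], counted from 1, is again [p.1]. *)
Lemma m_le_shift_graph J g k :
    (forall q, q \in ordered_pairs n -> J 'X_[pair_mnm q]%R <-> leading_pair G g q) ->
    k < n ->
  m_le k (@shift_graph K n J) + #|nonleading A g 1| = #|nonleading A g k.+1|.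
Proof.
move=> JP kn; rewrite addnC -(cardsID (nonleading A g 1) (nonleading A g k.+1)).
congr (_ + _).
  apply: eq_card => p; rewrite !inE.
  by case: (p.1 <= p.2); rewrite ?andbF //=; case: (leading_pair _ _ _); rewrite ?andbF //= !andbT; lia.
pose pred_ord (i : 'I_n) : 'I_n := Ordinal (leq_ltn_trans (leq_pred i) (ltn_ord i)).
pose f (p : 'I_n * 'I_n) := (pred_ord p.1, p.2).
have TP p : (p \in nonleading A g k.+1 :\: nonleading A g 1) =
    [&& p.1 <= p.2, 0 < p.1, p.1 <= k & ~~ leading_pair G g p].
  rewrite !inE; case: (p.1 <= p.2) => //=; case: (leading_pair _ _ _) => //=; rewrite ?andbF ?andbT //.
  by rewrite -leqNgt ltnS.
rewrite -(card_in_imset (f := f)); last first.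
  move=> [i j] [k' l]; rewrite !TP /= => /and4P[_ i0 _ _] /and4P[_ k0 _ _] [ik ->].
  by congr pair; apply: val_inj; rewrite /= -(prednK i0) -(prednK k0) ik.
apply: eq_card => -[u v]; rewrite inE /=; apply/and3P/imsetP.
  move=> [uv /boolp.asboolP[] [i [j [i0 ij Gij ui vj]]] minle]; last first.
    by exfalso; move: uv ij ui; rewrite -vj /=; lia.
  subst j; exists (i, v); last by congr pair; apply: val_inj.
  have pD : (i, v) \in ordered_pairs n by rewrite inE.
  rewrite TP /= ij i0 /=; apply/andP; split; first by move: minle ui i0; rewrite /=; lia.
  by apply/(GIN_pairP JP pD).
move=> [[i j]]; rewrite TP /= => /and4P[ij i0 ik nl] [-> ->]; split.
- by rewrite /=; lia.
- apply/boolp.asboolP; left; exists i, j; split=> //.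
  by apply/(GIN_pairP (p := (i, j)) JP) => //; rewrite inE.
by rewrite /=; lia.
Qed.

(** The open set defining the generic initial ideal and general position share a point [h], up to a
    scalar that [leading_pairZ] removes. *)
Lemma gin_leading_pairs J : is_gin (graph_ideal (K := K) G) J ->
  exists h, [/\ h \in unitmx, in_general_position h &
    forall q, q \in ordered_pairs n -> J 'X_[pair_mnm q]%R <-> leading_pair G (invmx h) q].
Proof.
move=> [U [Uopen U0 UJ]].
have [h [[uh [s s0 Us]] hP]] := generic_ex
  (generic_and charK0 (generic_zariski charK0 Uopen U0) (generic_general_position n charK0)).
exists h; split=> // q qD; rewrite (UJ _ Us) -(leading_pairZ G (invmx h) s0).
exact: initial_pairP.
Qed.

End GenericInitialIdeal.

(** * The three ranges of [k] *)

Theorem theorem2p5 (K : fieldType) (charK0 : [pchar K]%R =i pred0)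
    (a b n : nat) (hba : b <= a) (hb : 0 < b) (hn : n = a + b)
    (A : {set 'I_n}) (hA : #|A| = a) (hAC : #|~: A| = b)
    (h alpha : nat) (halpha : 0 < alpha) (hh : alpha <= h)
    (hrep : n = 'C(h, 2) + alpha)
    (D : sgraph n) (hD : is_symmetric_shift K (complete_bipartite A) D)
    (k : nat) (hk1 : 1 <= k) (hkn : k <= n - 1) :
  m_le k D =
    if k <= b - 1 then
      if k <= h - 2 then 'C(n, 2) - 'C(n - k, 2)
      else (k + 1) * n - (k + 1) ^ 2
    else a * b.
Proof.
have [J ginJ ->] := hD.
have [g [ug gP JP]] := gin_leading_pairs charK0 ginJ.
have kn : k < n by lia.
have A0 : A != set0 by rewrite -card_gt0 hA; lia.
have small m : m <= b -> #|nonleading A (invmx g) m| + ('C(m.+1, 2) - n) + 'C(m, 2) = m * n.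
  by move=> mb; apply: card_nonleading_small; rewrite // ?hA ?hAC // (leq_trans mb).
(* For [m = 1] the truncated difference [1 - n] is zero. *)
have N1 : #|nonleading A (invmx g) 1| = n.
  by have := small 1 hb; rewrite binn (bin_small (ltnSn 1)); lia.
have := m_le_shift_graph JP kn; rewrite N1.
have binh : 'C(h.+1, 2) = 'C(h, 2) + h by rewrite binS bin1.
case: ifP => kb; last first.
  by rewrite card_nonleading_large ?hA ?hAC //; lia.
have kb' : k.+1 <= b by lia.
have := small k.+1 kb'.
have e1 := bin2_square k.+1; have e2 : 'C(k.+1, 2) = 'C(k, 2) + k by rewrite binS bin1.
case: ifP => kh.
  (* Since [k] is positive, [h - 2] is not truncated. Hence ['C(k.+2, 2) <= 'C(h, 2) < n], and no
     nonzero quadric passes through the points. *)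
  have kh2 : k.+2 <= h by case: h hh halpha hrep kh {binh} => [|[|h']]; rewrite ?bin0n /=; lia.
  have le := leq_bin2l 2 kh2.
  have := bin2_addn (n - k) k; rewrite subnK ?(ltnW kn) //.
  have e3 := bin2_square k.
  nia.
(* Here ['C(k.+2, 2) >= 'C(h, 2) + h >= n], so the difference in [small] is a true one. *)
have : 'C(h.+1, 2) <= 'C(k.+2, 2) by apply: leq_bin2l; lia.
rewrite -mulnn; nia.
Qed.
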